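(* Let $0<q<\tfrac12$ and $\bar p(v)=1$ for all $v\in\Omega=[0,1]$. If the transformed equation $$\mathcal M^q\bar u(v)=\bar u(v)+\bar f(v)+\lambda\int_0^v\tilde K(v,w)\,\bar u(w)\,dw,\qquad v\in\Omega,\qquad \bar u(0)=0,$$ has a unique solution $\bar u(v)$, then for all sufficiently large $N$ the linear discrete Galerkin system $$\sum_{j=1}^{N}a_j\Big\{\big(\Psi_{j,q},G_{i-1}^{0,1}\big)_{0,0}-\big(G_j^{0,-1},G_{i-1}^{0,1}\big)_{N,0,0}-\lambda\big(\mathcal K_{N,\theta}(G_j^{0,-1}),G_{i-1}^{0,1}\big)_{N,0,0}\Big\}=\big(\bar f,G_{i-1}^{0,1}\big)_{N,0,0},\qquad i=1,\dots,N,$$ for the unknown coefficients $a_1,\dots,a_N$ has a unique solution, i.e. there is a unique discrete Galerkin solution $\bar u_N(v)=\sum_{i=1}^N a_i G_i^{0,-1}(v)\in\mathcal P_N$.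
   Context: Original problem. For $q\in(0,1)$ consider the fractional integro-differential equation $\mathcal D^q u(x)=p(x)u(x)+f(x)+\lambda\int_0^x K(x,t)u(t)\,dt$, $x\in\Omega=[0,1]$, $u(0)=0$, where $p,f$ are given continuous functions on $\Omega$, $K(x,t)$ is a given sufficiently smooth kernel on $\{(x,t):0\le t\le x\le 1\}$, $\lambda$ is a constant, and $\mathcal D^q u(x)=\frac{1}{\Gamma(1-q)}\int_0^x (x-s)^{-q}u'(s)\,ds$ is the Caputo derivative. Transformed problem. The substitution $x=v^{1/q}$, $t=w^{1/q}$ gives $\mathcal M^q\bar u(v)=\bar p(v)\bar u(v)+\bar f(v)+\lambda\int_0^v\tilde K(v,w)\bar u(w)\,dw$ with $\bar u(0)=0$, where $\bar u(v)=u(v^{1/q})$, $\bar p(v)=p(v^{1/q})$, $\bar f(v)=f(v^{1/q})$, $$\tilde K(v,w)=\frac{w^{1/q-1}}{q}K(v^{1/q},w^{1/q}),\qquad \mathcal M^q\bar u(v)=\frac{1}{\Gamma(1-q)}\int_0^v\big(v^{1/q}-w^{1/q}\big)^{-q}\bar u'(w)\,dw.$$ Polynomials. $\mathcal P_N$ is the space of algebraic polynomials of degree at most $N$. For $n\ge 0$, $$G_n^{0,1}(v)=J_n^{0,1}(v)=\sum_{k=0}^{n}(-1)^{n-k}\frac{(n+k+1)!}{(k+1)!\,(n-k)!\,k!}v^k$$ is the shifted Jacobi polynomial on $[0,1]$ with indices $(0,1)$, and for $i\ge 1$ the shifted generalized Jacobi polynomial with indices $(0,-1)$ is $$G_i^{0,-1}(v)=2v\,J_{i-1}^{0,1}(v)=2\sum_{k=0}^{i-1}(-1)^{i-1-k}\frac{(i+k)!}{(k+1)!\,(i-1-k)!\,k!}v^{k+1}.$$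 Inner products and discrete operator. $(g,h)_{0,0}=\int_0^1 g(v)h(v)\,dv$. Let $\{\theta_k\}_{k=0}^N$ and $\{\delta_k\}_{k=0}^N$ be the nodes and weights of the $(N+1)$-point Legendre–Gauss quadrature formula shifted to $[0,1]$, and set $(g,h)_{N,0,0}=\sum_{k=0}^N g(\theta_k)h(\theta_k)\delta_k$ and $$\mathcal K_{N,\theta}(g)(v)=v\sum_{k=0}^N\tilde K(v,v\theta_k)\,g(v\theta_k)\,\delta_k .$$ This is the quadrature approximation of $\int_0^v\tilde K(v,w)g(w)\,dw=v\int_0^1\tilde K(v,v\theta)g(v\theta)\,d\theta$. Finally, $$\Psi_{j,q}(v)=\mathcal M^qG_j^{0,-1}(v)=\frac{2}{\Gamma(1-q)}\sum_{k=0}^{j-1}(-1)^{j-1-k}\frac{(j+k)!}{(k!)^2(j-1-k)!}\left(\frac{q\pi\csc(\pi q)\,\Gamma(q+qk)}{\Gamma(q)\,\Gamma(1+kq)}\right)v^k .$$ *)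

(* Defs.v *)
From HB Require Import structures.
From mathcomp Require Export all_boot all_order all_algebra.
From mathcomp Require Export all_classical all_reals all_analysis.
Export Order.TTheory GRing.Theory Num.Theory.
Export numFieldNormedType.Exports.

Set Implicit Arguments.
Unset Strict Implicit.
Unset Printing Implicit Defensive.

Local Open Scope classical_set_scope.
Local Open Scope ring_scope.

Section CaputoOperator.
Context {R : realType}.
Local Notation mu := (@lebesgue_measure R).

Definition Gamma (z : R) : R :=
  Rintegral mu `]0, +oo[ (fun t => t `^ (z - 1) * expR (- t)).

Definition Mq_integrand (q : R) (u : R -> R) (v w : R) : R :=
  (v `^ q^-1 - w `^ q^-1) `^ (- q) * derive1 u w.

Definition Mq_pos (q : R) (u : R -> R) (v : R) : R :=
  (Gamma (1 - q))^-1 * Rintegral mu `[0, v] (Mq_integrand q u v).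

(* At v = 0 the integral is over a null set although M^q u(v) has in general a
   nonzero limit there: M^q maps v^(k+1) to a nonzero multiple of v^k. The
   value at 0 is that limit. *)
Definition Mq (q : R) (u : R -> R) (v : R) : R :=
  if v == 0 then lim (Mq_pos q u w @[w --> 0^'+]) else Mq_pos q u v.

Definition bar (q : R) (g : R -> R) (v : R) : R := g (v `^ q^-1).

Definition Ktilde (q : R) (K : R -> R -> R) (v w : R) : R :=
  w `^ (q^-1 - 1) / q * K (v `^ q^-1) (w `^ q^-1).

Definition triangle : set (R * R) := [set z | 0 <= z.2 <= z.1 /\ z.1 <= 1].

(* The partial derivatives exist in the interior of the triangle and extend
   continuously to the closed triangle. *)
Definition C1_on_triangle (K : R -> R -> R) : Prop :=
  {within triangle, continuous (fun z : R * R => K z.1 z.2)} /\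
  exists K1 K2 : R * R -> R,
    [/\ {within triangle, continuous K1},
        {within triangle, continuous K2} &
        forall x t : R, 0 < t -> t < x -> x < 1 ->
          is_derive x 1 (K ^~ t) (K1 (x, t)) /\
          is_derive t 1 (K x) (K2 (x, t))].

(* The third clause says that the integral defining M^q u(v) converges
   absolutely for every v in ]0, 1]. *)
Definition transformed_solution (q lambda : R) (p f : R -> R)
    (K : R -> R -> R) (u : R -> R) : Prop :=
  [/\ derivable_oo_LRcontinuous u 0 1,
      u 0 = 0,
      forall v : R, 0 < v <= 1 ->
        mu.-integrable `[0, v] (EFin \o Mq_integrand q u v) &
      forall v : R, 0 <= v <= 1 ->
        Mq q u v = bar q p v * u v + bar q f v
          + lambda * Rintegral mu `[0, v] (fun w => Ktilde q K v w * u w)].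

End CaputoOperator.

Section Polynomials.
Context {R : realType}.
Local Notation mu := (@lebesgue_measure R).

Definition jacobi01 (n : nat) : {poly R} :=
  \poly_(k < n.+1) ((-1) ^+ (n - k) * ((n + k + 1)`!)%:R
                    / ((k + 1)`!%:R * (n - k)`!%:R * k`!%:R)).

(* Meaningful for i >= 1 only. *)
Definition jacobi0N1 (i : nat) : {poly R} := 2%:R *: ('X * jacobi01 i.-1).

(* Rodrigues' formula on [0, 1]; p^`N(n) is the n-th derivative divided by n!. *)
Definition legendre (n : nat) : {poly R} := (('X^2 - 'X) ^+ n)^`N(n).

Definition lagrange_basis (N : nat) (theta : 'I_N.+1 -> R) (k : 'I_N.+1) :
    {poly R} :=
  \prod_(i < N.+1 | i != k)
    ((theta k - theta i)^-1 *: ('X - (theta i)%:P)).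

(* The N+1 nodes are the N+1 zeros of the Legendre polynomial of degree N+1,
   and the weights are those of interpolatory quadrature. *)
Definition legendre_gauss (N : nat) (theta delta : 'I_N.+1 -> R) : Prop :=
  [/\ injective theta,
      forall k, root (legendre N.+1) (theta k) &
      forall k, delta k =
        Rintegral mu `[0, 1] (fun x => (lagrange_basis theta k).[x])].

Definition inner (g h : R -> R) : R := Rintegral mu `[0, 1] (fun v => g v * h v).

Definition inner_disc (N : nat) (theta delta : 'I_N.+1 -> R) (g h : R -> R) : R :=
  \sum_(k < N.+1) g (theta k) * h (theta k) * delta k.

Definition KN (q : R) (K : R -> R -> R) (N : nat) (theta delta : 'I_N.+1 -> R)
    (g : R -> R) (v : R) : R :=
  v * \sum_(k < N.+1) Ktilde q K v (v * theta k) * g (v * theta k) * delta k.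

Definition Psi (q : R) (j : nat) : R -> R := Mq q (horner (jacobi0N1 j)).

(* Indices i, j : 'I_N run from 0, so they stand for i+1 and j+1. *)
Definition galerkin_system (q lambda : R) (f : R -> R) (K : R -> R -> R)
    (N : nat) (theta delta : 'I_N.+1 -> R) (a : 'rV[R]_N) : Prop :=
  forall i : 'I_N,
    \sum_(j < N) a 0 j *
      (inner (Psi q j.+1) (horner (jacobi01 i))
       - inner_disc theta delta (horner (jacobi0N1 j.+1)) (horner (jacobi01 i))
       - lambda * inner_disc theta delta
                    (KN q K theta delta (horner (jacobi0N1 j.+1)))
                    (horner (jacobi01 i)))
    = inner_disc theta delta (bar q f) (horner (jacobi01 i)).

Definition galerkin_solution (q lambda : R) (f : R -> R) (K : R -> R -> R)
    (N : nat) (theta delta : 'I_N.+1 -> R) (uN : {poly R}) : Prop :=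
  (size uN <= N.+1)%N /\
  exists a : 'rV[R]_N, galerkin_system q lambda f K theta delta a /\
    uN = \sum_(i < N) a 0 i *: jacobi0N1 i.+1.

End Polynomials.

(* Main.v *)
Require Import Defs.
From HB Require Import structures.
From mathcomp Require Import measurable_realfun ring lra zify.

(** The system is linear and square, so it suffices that for large N the
homogeneous system has only the zero solution; the continuous equation is of
Volterra type, which gives this without appeal to the hypothesis on its
solutions.

Let u = X t be a homogeneous solution and g = M^q u, again a polynomial, since
M^q maps X^(m+1) to kappa_m X^m. Gauss quadrature is exact up to degree 2N + 1,
hence so is the discretised Volterra operator once its kernel is replaced by a
polynomial: K_N u is uniformly within eps |u| of a Volterra operator T u with
separated polynomial kernel, eps being independent of N. Bernstein polynomials
of degree below N approximate T u up to eps |u|, because T u has modulus of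
continuity C |u| h^(1/2), and u itself is within |g| / kappa_(N-1) of degree
below N. Testing the system with what remains gives
  |g - u - lambda T u| <= small (|g| + |u|).

Conversely, M^q u(v) is a multiple of the integral of k(s) u'(vs) over [0, 1],
with k = (1 - s^(1/q))^(-q) increasing and unbounded. Abel summation in s,
against the decreasing weight W = (2 - v)^n, gives the energy inequality
  C int W u^2 <= int W u (M^q u),
where C is as large as desired if n is. Since T is bounded in the weighted norm
by a constant independent of n, this bounds |g| by a multiple of
|g - u - lambda T u|, and therefore u = 0. *)

(** The test polynomials have degree below N while u has degree N, so the residual cannot be tested
    with itself. What is missing is the top monomial of u, and the growth of kappa_m with m makes it
    negligible.

    The operator lambda T is not small, so positivity of M^q alone would not absorb it; hence an
    energy inequality with an arbitrarily large constant C. The weight is a power of 2 - v rather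
    than an exponential so that every integral in that argument is the integral of a polynomial.

    The constants are chosen in the order M (a bound of the kernel), n, eps, N. The discrete system
    controls the residual in the unweighted norm and the energy inequality works in the weighted
    one; passing from one to the other costs 2^n, which eps and 1 / kappa_(N-1) must absorb. *)

Set Implicit Arguments.
Unset Strict Implicit.
Unset Printing Implicit Defensive.

Local Open Scope classical_set_scope.
Local Open Scope ring_scope.

(** * Integrals of polynomials over [0, 1] *)

Section PolynomialIntegral.
Context {R : realType}.
Implicit Types (p r w : {poly R}).
Local Notation mu := (@lebesgue_measure R).

Lemma derivable_poly p (x : R) : derivable (horner p) x 1.
Proof. exact (@derivable_horner R p x). Qed.

Definition prim p : {poly R} := \poly_(i < (size p).+1) (p`_i.-1 / i%:R).

(* At i = 0 the right-hand side is 0, because x / 0 = 0. *)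
Lemma coef_prim p i : (prim p)`_i = p`_i.-1 / i%:R.
Proof.
rewrite coef_poly; case: ltnP => // si.
by rewrite nth_default ?mul0r //; case: i si.
Qed.

Lemma primD p r : prim (p + r) = prim p + prim r.
Proof. by apply/polyP => i; rewrite !(coefD, coef_prim) mulrDl. Qed.

Lemma primZ a p : prim (a *: p) = a *: prim p.
Proof. by apply/polyP => i; rewrite !(coefZ, coef_prim) mulrA. Qed.

Lemma deriv_prim p : (prim p)^`() = p.
Proof.
by apply/polyP => i; rewrite coef_deriv coef_prim -[_ *+ _]mulr_natr divfK.
Qed.

Lemma prim0 p : (prim p).[0] = 0.
Proof. by rewrite horner_coef0 coef_prim invr0 mulr0. Qed.

Lemma prim_deriv p : prim p^`() = p - p.[0]%:P.
Proof.
apply/polyP => i; rewrite coef_prim coefB coefC coef_deriv horner_coef0.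
case: i => [|i] /=; first by rewrite invr0 mulr0 subrr.
by rewrite -[_ *+ i.+1]mulr_natr mulfK ?subr0 // pnatr_eq0.
Qed.

Lemma prim_inj p : prim p = 0 -> p = 0.
Proof. by move=> h; rewrite -[p]deriv_prim h deriv0. Qed.

Definition pint p : R := (prim p).[1].

Lemma pint_linear : linear pint.
Proof. by move=> a p r; rewrite /pint primD primZ hornerD hornerZ. Qed.

HB.instance Definition _ :=
  GRing.isLinear.Build R {poly R} R _ pint pint_linear.

Lemma prim_homo p a b : a <= b -> (forall x, a <= x <= b -> 0 <= p.[x]) ->
  (prim p).[a] <= (prim p).[b].
Proof.
move=> ab p0.
apply: (@ger0_derive1_ndecr R (horner (prim p)) a b) => //.
- move=> x; rewrite in_itv /= => /andP[/ltW ax /ltW xb].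
  by rewrite -derivE deriv_prim p0 // ax xb.
- by move=> x; apply: continuous_subspaceT; exact: continuous_horner.
Qed.

Lemma pint_ge0 p : (forall x, 0 <= x <= 1 -> 0 <= p.[x]) -> 0 <= pint p.
Proof. by move=> h; rewrite -(prim0 p); exact: prim_homo. Qed.

Lemma ler_pint p r : (forall x, 0 <= x <= 1 -> p.[x] <= r.[x]) ->
  pint p <= pint r.
Proof.
move=> h; rewrite -subr_ge0 -linearB; apply: pint_ge0 => x x01.
by rewrite !hornerE subr_ge0 h.
Qed.

(** The reciprocals of 1, ..., [size p] lie in [0, 1] and are more roots than a nonzero p can
    have. *)
Lemma poly_eq0_itv p : (forall x, 0 <= x <= 1 -> p.[x] = 0) -> p = 0.
Proof.
move=> h; apply/eqP; apply: contraT => p0.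
have sz := @max_poly_roots R p [seq (i.+1%:R)^-1 | i <- iota 0 (size p)] p0.
suff : (size p < size p)%N by rewrite ltnn.
rewrite -[X in (X < _)%N](size_iota 0) -(size_map (fun i : nat => i.+1%:R^-1 : R)).
apply: sz.
  apply/allP => _ /mapP[i _ ->]; rewrite rootE h //.
  by rewrite invr_ge0 ler0n invf_le1 ?ltr0n // ler1n.
rewrite map_inj_uniq ?iota_uniq // => i j /invr_inj /eqP.
by rewrite eqr_nat eqSS => /eqP.
Qed.

(** The primitive is monotone on [0, 1] and vanishes at both ends, hence on the whole interval. *)
Lemma pint_eq0 p : (forall x, 0 <= x <= 1 -> 0 <= p.[x]) -> pint p = 0 -> p = 0.
Proof.
move=> h p0; apply: prim_inj; apply: poly_eq0_itv => x /andP[x0 x1].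
apply/eqP; rewrite eq_le; apply/andP; split.
  rewrite -p0; apply: prim_homo => // y /andP[xy y1].
  by rewrite h // y1 (le_trans x0).
rewrite -(prim0 p); apply: prim_homo => // y /andP[y0 yx].
by rewrite h // y0 (le_trans yx).
Qed.

Lemma pint_gt0 p : (forall x, 0 <= x <= 1 -> 0 <= p.[x]) -> p != 0 -> 0 < pint p.
Proof.
move=> h p0; rewrite lt_neqAle pint_ge0 // andbT eq_sym.
by apply: contra_neq p0; exact: pint_eq0.
Qed.

Lemma pint_deriv p : pint p^`() = p.[1] - p.[0].
Proof. by rewrite /pint prim_deriv !hornerE. Qed.

Lemma pint_by_parts p r :
  pint (p^`() * r) = p.[1] * r.[1] - p.[0] * r.[0] - pint (p * r^`()).
Proof.
have := pint_deriv (p * r); rewrite derivM linearD /= !hornerM => <-.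
by rewrite addrK.
Qed.

Lemma pint_C c : pint c%:P = c.
Proof.
have -> : c%:P = (c *: 'X)^`() :> {poly R} by rewrite derivZ derivX alg_polyC.
by rewrite pint_deriv !hornerE subr0.
Qed.

Lemma integrable_horner p a b : mu.-integrable `[a, b] (EFin \o horner p).
Proof.
apply: continuous_compact_integrable; first exact: segment_compact.
by apply: continuous_subspaceT; exact: continuous_horner.
Qed.

Lemma Rintegral_prim p a b : a <= b ->
  Rintegral mu `[a, b] (horner p) = (prim p).[b] - (prim p).[a].
Proof.
rewrite le_eqVlt => /predU1P[->|ab].
  by rewrite set_itv1 Rintegral_set1 subrr.
rewrite /Rintegral (@continuous_FTC2 _ _ (horner (prim p))) //.
- by apply: continuous_subspaceT; exact: continuous_horner.
- split; first by move=> x _; exact: derivable_poly.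
  + by apply: cvg_at_right_filter; exact: continuous_horner.
  + by apply: cvg_at_left_filter; exact: continuous_horner.
- by move=> x _; rewrite -derivE deriv_prim.
Qed.

Lemma Rintegral_pint p : Rintegral mu `[0, 1] (horner p) = pint p.
Proof. by rewrite Rintegral_prim // prim0 subr0. Qed.

(* The substitution w = s v in the integral of p over [0, s]. *)
Lemma pint_scale p s : s * pint (p \Po (s *: 'X)) = (prim p).[s].
Proof.
rewrite /pint -hornerZ.
have -> : s *: prim (p \Po (s *: 'X)) = prim p \Po (s *: 'X).
  have := prim_deriv (prim p \Po (s *: 'X)).
  rewrite horner_comp !hornerE ?mulr0 prim0 polyC0 subr0 => <-.
  rewrite deriv_comp deriv_prim derivZ derivX -primZ.
  by rewrite alg_polyC mulrC mul_polyC.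
by rewrite horner_comp !hornerE.
Qed.

(** By [pint_scale] the left-hand side is the integral of p over [0, s] only. *)
Lemma pint_scale_le p s : 0 <= s <= 1 -> (forall x, 0 <= x <= 1 -> 0 <= p.[x]) ->
  s * pint (p \Po (s *: 'X)) <= pint p.
Proof.
move=> /andP[s0 s1] h; rewrite pint_scale; apply: prim_homo => // x /andP[sx x1].
by rewrite h // x1 (le_trans s0).
Qed.

End PolynomialIntegral.

(** * Gauss quadrature *)

Section Legendre.
Context {R : realType}.
Implicit Types (p r w : {poly R}).

Lemma derivn_exp_factor w n j : (j <= n)%N ->
  exists r, (w ^+ n)^`(j) = w ^+ (n - j) * r.
Proof.
elim: j => [|j IH] jn; first by exists 1; rewrite derivn0 subn0 mulr1.
have [r hr] := IH (ltnW jn).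
exists (w^`() * r *+ (n - j) + w * r^`()).
have -> : (n - j = (n - j.+1).+1)%N by lia.
rewrite derivnS hr derivM deriv_exp.
have -> : (n - j = (n - j.+1).+1)%N by lia.
by rewrite /= exprS; ring.
Qed.

Lemma horner_rodrigues_factor n j x : (j < n)%N -> x ^+ 2 = x ->
  ((('X^2 - 'X : {poly R}) ^+ n)^`(j)).[x] = 0.
Proof.
move=> jn hx; have [r ->] := derivn_exp_factor ('X^2 - 'X) (ltnW jn).
rewrite hornerM horner_exp !hornerE hx subrr expr0n.
by rewrite subn_eq0 leqNgt jn mul0r.
Qed.

(** Integrating by parts j times moves every derivative onto r and kills it; the boundary terms
    vanish because 0 and 1 are roots of X^2 - X of multiplicity n after taking the n-th power. *)
Lemma pint_rodrigues n j r : (j <= n)%N -> (size r <= j)%N ->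
  pint ((('X^2 - 'X) ^+ n)^`(j) * r) = 0.
Proof.
elim: j r => [|j IH] r jn sr.
  by move: sr; rewrite leqn0 size_poly_eq0 => /eqP ->; rewrite mulr0 raddf0.
rewrite derivnS pint_by_parts !horner_rodrigues_factor ?expr1n ?expr0n //.
rewrite !mul0r subrr sub0r IH ?oppr0 ?(ltnW jn) //.
have [->|r0] := eqVneq r 0; first by rewrite deriv0 size_poly0.
by rewrite -ltnS (leq_trans (lt_size_deriv r0)).
Qed.

Lemma legendre_orthogonal n r : (size r <= n)%N -> pint (legendre n * r) = 0.
Proof.
move=> sr; have := @pint_rodrigues n n r (leqnn n) sr.
rewrite nderivn_def -/(legendre n) mulrnAl linearMn /= => /eqP.
by rewrite mulrn_eq0 -leqn0 leqNgt fact_gt0 /= => /eqP.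
Qed.

(** The power of X^2 - X is monic of degree 2n, so its divided n-th derivative has a binomial
    coefficient in degree n and nothing above. *)
Lemma size_legendre n : size (legendre n : {poly R}) = n.+1.
Proof.
have mw : ('X^2 - 'X : {poly R}) \is monic.
  by rewrite monicE lead_coefDl ?lead_coefXn // size_polyN size_polyX size_polyXn.
have sw : size ('X^2 - 'X : {poly R}) = 3%N.
  by rewrite size_polyDl size_polyXn // size_polyN size_polyX.
have sz : size (('X^2 - 'X : {poly R}) ^+ n) = (n + n).+1.
  have : size (('X^2 - 'X : {poly R}) ^+ n) != 0%N.
    by rewrite size_poly_eq0 monic_neq0 // monic_exp.
  have := size_exp ('X^2 - 'X : {poly R}) n; rewrite sw /=.
  by case: (size _) => //= k -> _; congr _.+1; lia.
apply/eqP; rewrite eqn_leq; apply/andP; split.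
  apply/leq_sizeP => j nj; rewrite coef_nderivn nth_default ?mul0rn //.
  by rewrite sz ltn_add2l.
rewrite ltnNge; apply/negP => /leq_sizeP /(_ n (leqnn n)) /eqP.
rewrite coef_nderivn mulrn_eq0 -leqn0 leqNgt bin_gt0 leq_addr /=.
have -> : (n + n = (size (('X^2 - 'X : {poly R}) ^+ n)).-1)%N by rewrite sz.
by rewrite -/(lead_coef _) lead_coef_eq0 (negPf (monic_neq0 _)) // monic_exp.
Qed.

End Legendre.

Section GaussQuadrature.
Context {R : realType} (N : nat) (theta delta : 'I_N.+1 -> R).
Hypothesis gauss : legendre_gauss theta delta.
Implicit Types (p r : {poly R}).

Local Notation omega := (\prod_(z <- codom theta) ('X - z%:P)).

Let theta_inj : injective theta. Proof. by case: gauss. Qed.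

Let uniq_theta : uniq (codom theta).
Proof. by rewrite map_inj_uniq ?enum_uniq. Qed.

Let size_theta : size (codom theta) = N.+1.
Proof. by rewrite size_codom card_ord. Qed.

Lemma legendre_nodes : legendre N.+1 = lead_coef (legendre N.+1) *: omega.
Proof.
apply: all_roots_prod_XsubC.
- by rewrite size_legendre size_theta.
- by apply/allP => _ /codomP[k ->]; case: gauss.
- by rewrite uniq_rootsE.
Qed.

Lemma pint_omega r : (size r <= N.+1)%N -> pint (omega * r) = 0.
Proof.
move=> /legendre_orthogonal /eqP; rewrite legendre_nodes -scalerAl linearZ /=.
rewrite mulf_eq0 lead_coef_eq0 -size_poly_eq0 size_legendre /=.
by move/eqP.
Qed.

Lemma lagrange_basis_node k j : (lagrange_basis theta k).[theta j] = (j == k)%:R.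
Proof.
rewrite /lagrange_basis horner_prod; case: eqP => [->|/eqP jk].
  rewrite big1 // => i ik; rewrite !hornerE mulVf // subr_eq0.
  by rewrite (inj_eq theta_inj) eq_sym.
by rewrite (bigD1 j) //= !hornerE subrr mulr0 mul0r.
Qed.

Lemma size_lagrange_basis k : (size (lagrange_basis theta k) <= N.+1)%N.
Proof.
rewrite /lagrange_basis; apply: (leq_trans (size_poly_prod_leq _ _)).
rewrite (@leq_trans ((\sum_(i < N.+1 | i != k) 2).+1 - #|[pred i | i != k]|)) //.
  rewrite leq_sub2r // ltnS; apply: leq_sum => i _.
  by rewrite (leq_trans (size_scale_leq _ _)) // size_XsubC.
rewrite sum_nat_const /= cardC1 card_ord /=; lia.
Qed.

Lemma eq_at_nodes p r : (size p <= N.+1)%N -> (size r <= N.+1)%N ->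
  (forall k, p.[theta k] = r.[theta k]) -> p = r.
Proof.
move=> sp sr h; apply/eqP; rewrite -subr_eq0; apply/eqP.
apply: (@roots_geq_poly_eq0 R _ (codom theta)) => //.
  by apply/allP => _ /codomP[k ->]; rewrite rootE !hornerE h subrr.
by rewrite size_theta (leq_trans (size_polyD _ _)) // size_polyN geq_max sp.
Qed.

(** Divide p by the nodal polynomial [omega]. The quotient is small enough to be orthogonal to
    [omega], and the remainder is its own Lagrange interpolant, on which the weights are exact by
    definition. *)
Lemma gauss_exact p : (size p <= N.+1 + N.+1)%N ->
  \sum_(k < N.+1) p.[theta k] * delta k = pint p.
Proof.
move=> sp.
have om : omega \is monic by exact: monic_prod_XsubC.
have so : size omega = N.+2 by rewrite size_prod_XsubC size_theta.
have -> : pint p = pint (p %% omega).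
  rewrite {1}[p](divp_eq p omega) linearD /= mulrC pint_omega ?add0r //.
  by rewrite size_divp ?monic_neq0 // so leq_subLR.
have -> : p %% omega = \sum_(k < N.+1) p.[theta k] *: lagrange_basis theta k.
  apply: eq_at_nodes.
  - by have := ltn_modp p omega; rewrite monic_neq0 // so ltnS.
  - apply: (leq_trans (size_sum _ _ _)); apply/bigmax_leqP => i _.
    exact: leq_trans (size_scale_leq _ _) (size_lagrange_basis _).
  move=> k; rewrite horner_sum [RHS](bigD1 k) //= [X in _ + X]big1 ?addr0; last first.
    by move=> i ik; rewrite hornerZ lagrange_basis_node eq_sym (negPf ik) mulr0.
  rewrite hornerZ lagrange_basis_node eqxx mulr1.
  rewrite {2}[p](divp_eq p omega) hornerD hornerM.
  have /eqP -> : root omega (theta k) by rewrite root_prod_XsubC codom_f.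
  by rewrite mulr0 add0r.
rewrite linear_sum /=; apply: eq_bigr => k _; rewrite linearZ /=.
by case: gauss => _ _ ->; rewrite Rintegral_pint.
Qed.

Lemma lagrange_basis_neq0 k : lagrange_basis theta k != 0.
Proof.
apply/eqP => /(congr1 (horner^~ (theta k))) /eqP.
by rewrite lagrange_basis_node eqxx horner0 oner_eq0.
Qed.

(** The quadrature is exact on the square of the k-th Lagrange polynomial, and only node k
    contributes to it. *)
Lemma gauss_weight_gt0 k : 0 < delta k.
Proof.
have -> : delta k = pint (lagrange_basis theta k ^+ 2).
  rewrite -gauss_exact; last first.
    rewrite expr2 (leq_trans (size_polyMleq _ _)) //.
    by have := size_lagrange_basis k; lia.
  rewrite (bigD1 k) //= big1 ?addr0; last first.
    by move=> j jk; rewrite horner_exp lagrange_basis_node (negPf jk) expr0n mul0r.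
  by rewrite horner_exp lagrange_basis_node eqxx expr1n mul1r.
apply: pint_gt0; last by rewrite expf_neq0 // lagrange_basis_neq0.
by move=> x _; rewrite horner_exp sqr_ge0.
Qed.

(* The quadrature of (x - theta_k) l_k(x)^2 vanishes, so the factor
   x - theta_k cannot keep a constant sign on [0, 1]. *)
Lemma gauss_node_itv k : 0 <= theta k <= 1.
Proof.
pose p : {poly R} := ('X - (theta k)%:P) * lagrange_basis theta k ^+ 2.
have sp : (size p <= N.+1 + N.+1)%N.
  rewrite /p (leq_trans (size_polyMleq _ _)) // size_XsubC.
  have : (size (lagrange_basis theta k ^+ 2) <= N.+1 + N)%N.
    rewrite expr2 (leq_trans (size_polyMleq _ _)) //.
    by have := size_lagrange_basis k; lia.
  by lia.
have p0 : p != 0.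
  by rewrite mulf_neq0 ?polyXsubC_eq0 // expf_neq0 // lagrange_basis_neq0.
have ip : pint p = 0.
  rewrite -gauss_exact // big1 // => j _.
  rewrite /p hornerM horner_exp lagrange_basis_node hornerXsubC.
  by case: eqP => [->|_]; rewrite ?subrr ?expr0n ?mulr0 ?mul0r.
have pE x : p.[x] = (x - theta k) * (lagrange_basis theta k).[x] ^+ 2.
  by rewrite /p !hornerE.
rewrite !leNgt; apply/andP; split; apply: contra_neqN p0 => h.
  apply: pint_eq0 => // x /andP[x0 _].
  by rewrite pE mulr_ge0 ?sqr_ge0 //; lra.
apply: oppr_inj; rewrite oppr0; apply: pint_eq0; last by rewrite linearN /= ip oppr0.
move=> x /andP[_ x1].
by rewrite hornerN pE -mulNr mulr_ge0 ?sqr_ge0 //; lra.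
Qed.

Lemma sum_gauss_weight : \sum_(k < N.+1) delta k = 1.
Proof.
rewrite -[RHS](pint_C (1 : R)) -gauss_exact ?size_polyC ?oner_eq0 //.
by apply: eq_bigr => k _; rewrite hornerC mul1r.
Qed.

End GaussQuadrature.

(** * The transformed Caputo operator on polynomials *)

Section AffineSubstitution.
Context {R : realType}.
Local Notation mu := (@lebesgue_measure R).

(** By uniqueness of Lebesgue measure, half-open intervals suffice; for b < 0 the preimage is open
    at the other end, which does not change its length. *)
Lemma lebesgue_measure_affine (a b : R) (A : set R) : b != 0 -> measurable A ->
  mu A = (`|b|%:E * mu [set s | A (a + b * s)%R])%E.
Proof.
move=> b0 mA.
pose phi (s : measurableTypeR R) : measurableTypeR R := a + b * s.
have mphi : measurable_fun [set: measurableTypeR R] phi.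
  by apply: measurable_funD => //; exact: measurable_funM.
have nb : 0 <= `|b| by [].
pose nu : {measure set (measurableTypeR R) -> \bar R} :=
  mscale (NngNum nb) (pushforward mu phi).
rewrite -[RHS]/(nu mphi A).
apply: lebesgue_measure_unique => // _ [[x y] _ <-].
change (mu `]x, y] = (`|b|%:E * mu [set s : R | (a + b * s)%R \in `]x, y]])%E).
have [b1|b1] : 0 < b \/ b < 0 by case: ltgtP b0; auto.
- have -> : [set s | a + b * s \in `]x, y]] = `](x - a) / b, (y - a) / b]%classic.
    apply/seteqP; split=> s /=; rewrite !in_itv /= ltr_pdivrMr // ler_pdivlMr //;
    by rewrite ltrBlDl lerBrDl mulrC.
  rewrite !lebesgue_measure_itv /= !lte_fin ltr_pM2r ?invr_gt0 // ltrD2r.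
  case: ifP => _; rewrite ?mule0 // -!EFinD -EFinM gtr0_norm //.
  by congr _%:E; field.
- have -> : [set s | a + b * s \in `]x, y]] = `[(y - a) / b, (x - a) / b[%classic.
    apply/seteqP; split=> s /=; rewrite !in_itv /= ltr_ndivlMr // ler_ndivrMr //;
    by rewrite ltrBlDl lerBrDl mulrC andbC.
  rewrite !lebesgue_measure_itv /= !lte_fin ltr_nM2r ?invr_lt0 // ltrD2r.
  case: ifP => _; rewrite ?mule0 // -!EFinD -EFinM ltr0_norm //.
  by congr _%:E; field.
Qed.

Lemma ge0_integral_affine (a b : R) (D : set R) (f : R -> \bar R) : b != 0 ->
  measurable D -> measurable_fun D f -> (forall x, D x -> 0 <= f x)%E ->
  (\int[mu]_(x in D) f x =
   `|b|%:E * \int[mu]_(s in [set s | D (a + b * s)%R]) f (a + b * s)%R)%E.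
Proof.
move=> b0 mD mf f0.
pose phi (s : measurableTypeR R) : measurableTypeR R := a + b * s.
have mphi : measurable_fun [set: measurableTypeR R] phi.
  by apply: measurable_funD => //; exact: measurable_funM.
have nb : 0 <= `|b| by [].
pose nu : {measure set (measurableTypeR R) -> \bar R} :=
  mscale (NngNum nb) (pushforward mu phi).
rewrite (eq_measure_integral (nu mphi)); last first.
  by move=> A mA _; exact: (lebesgue_measure_affine a b0 mA).
rewrite ge0_integral_mscale //; congr (_ * _)%E.
rewrite ge0_integral_pushforward // => x; rewrite inE; exact: f0.
Qed.

End AffineSubstitution.

(** * Integrability of t^(-q) at 0 and positivity of Gamma (1 - q) *)

Section PowerIntegrals.
Context {R : realType} (q : R).
Hypotheses (q_gt0 : 0 < q) (q_lt1 : q < 1).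
Local Notation mu := (@lebesgue_measure R).

Let q1_gt0 : 0 < 1 - q. Proof. by rewrite subr_gt0. Qed.

Lemma measurable_powRN D : measurable_fun D (fun t : R => (t `^ (- q))%:E).
Proof. by apply/measurable_EFinP; apply: measurable_funTS. Qed.

Lemma integral_powRN_segment a b : 0 < a -> a < b ->
  (\int[mu]_(t in `[a, b]) (t `^ (- q))%:E =
   ((b `^ (1 - q) - a `^ (1 - q)) / (1 - q))%:E)%E.
Proof.
move=> a0 ab; have b0 := lt_trans a0 ab.
have d (x : R) : 0 < x ->
    is_derive x 1 (fun t : R => (1 - q)^-1 * t `^ (1 - q)) (x `^ (- q)).
  move=> x0; have h := @is_derive1_powR R (1 - q) x x0.
  apply: (is_derive_eq (is_deriveZ (1 - q)^-1 h)).
  by rewrite /GRing.scale /= mulrA mulVf ?gt_eqF // mul1r addrAC subrr add0r.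
have cp (x : R) r : 0 < x -> {for x, continuous (fun t : R => t `^ r)}.
  move=> x0; apply: differentiable_continuous; apply/derivable1_diffP.
  by apply: ex_derive; exact: is_derive1_powR.
rewrite (@continuous_FTC2 _ _ (fun t => (1 - q)^-1 * t `^ (1 - q))) //.
- by rewrite -EFinB -mulrBr mulrC.
- apply: continuous_in_subspaceT => x; rewrite inE /= in_itv /= => /andP[ax _].
  by apply: cp; exact: lt_le_trans ax.
- split.
  + by move=> x; rewrite in_itv /= => /andP[ax _]; have := d x (lt_trans a0 ax); case.
  + apply: cvg_at_right_filter; apply: cvgM; first exact: cvg_cst.
    exact: cp.
  + apply: cvg_at_left_filter; apply: cvgM; first exact: cvg_cst.
    exact: cp.
- move=> x; rewrite in_itv /= => /andP[ax _].
  by rewrite derive1E; apply: derive_val; exact: d (lt_trans a0 ax).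
Qed.

(** The integrand is unbounded at 0, so the fundamental theorem of calculus is applied on segments
    that exhaust ]0, a], followed by monotone convergence. *)
Lemma integral_powRN_le a : 0 < a ->
  (\int[mu]_(t in `[0%R, a]) (t `^ (- q))%:E <= (a `^ (1 - q) / (1 - q))%:E)%E.
Proof.
move=> a0; rewrite -integral_itv_obnd_cbnd; last exact: measurable_powRN.
(* The shift by 2 keeps each segment nondegenerate, as [integral_powRN_segment] requires. *)
pose F n := `[a / n.+2%:R, a]%classic.
have -> : `]0, a]%classic = \bigcup_n F n.
  apply/seteqP; split=> [x|x [n _]]; rewrite /F /= !in_itv /= => /andP[x0 xa].
    have [n hn] := ltr_add_invr (divr_gt0 x0 a0); rewrite add0r in hn.
    exists n => //=; rewrite in_itv /= xa andbT ler_pdivrMr ?ltr0n //.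
    move: hn; rewrite ltr_pdivlMr // mulrC ltr_pdivrMr ?ltr0n // => /ltW /le_trans.
    by apply; rewrite ler_pM2l // ler_nat.
  by rewrite xa (lt_le_trans _ x0) // divr_gt0.
have nd : nondecreasing_seq F.
  move=> m n mn; apply/subsetPset => x; rewrite /F /= !in_itv /= => /andP[h ->].
  by rewrite andbT (le_trans _ h) // ler_pM2l // lef_pV2 ?posrE ?ltr0n // ler_nat.
have cv : (\int[mu]_(x in F i) (x `^ (- q))%:E @[i --> \oo] -->
    \int[mu]_(x in \bigcup_i F i) (x `^ (- q))%:E)%E.
  apply: ge0_nondecreasing_set_cvg_integral => //.
  - by move=> i; exact: measurable_itv.
  - by move=> i; exact: measurable_powRN.
  - by move=> i x _; rewrite lee_fin powR_ge0.
rewrite -(cvg_lim _ cv) //; apply: lime_le; first by apply/cvg_ex; eexists; exact: cv.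
apply: nearW => n; rewrite /F integral_powRN_segment ?divr_gt0 //; last first.
  by rewrite ltr_pdivrMr ?ltr0n // ltr_pMr // ltr1n.
by rewrite lee_fin ler_pM2r ?invr_gt0 // gerBl powR_ge0.
Qed.

(** [Rintegral] sends an infinite integral to 0, so positivity needs finiteness as well: t^(-q)
    dominates the integrand on ]0, 1] and the exponential density on ]1,
    +oo[. The lower bound e^(-1) comes from ]0, 1]. *)
Lemma Gamma_onem_gt0 : 0 < Gamma (1 - q).
Proof.
pose f (t : R) := t `^ (1 - q - 1) * expR (- t).
have fE t : f t = t `^ (- q) * expR (- t) by rewrite /f addrAC subrr add0r.
have f0 t : 0 <= f t by rewrite mulr_ge0 ?powR_ge0 ?expR_ge0.
have mexp D : measurable_fun D (fun t : R => expR (- t)).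
  apply: measurable_funTS; apply: measurableT_comp => //.
have mf D : measurable_fun D (EFin \o f).
  by apply/measurable_EFinP; apply: measurable_funM => //; exact: measurable_funTS.
have split : (\int[mu]_(t in `]0%R, +oo[) (f t)%:E =
    \int[mu]_(t in `]0%R, 1%R]) (f t)%:E + \int[mu]_(t in `]1%R, +oo[) (f t)%:E)%E.
  rewrite -ge0_integral_setU //.
  - by rewrite -itv_bndbnd_setU // bnd_simp.
  - exact: mf.
  - by move=> x _; rewrite lee_fin.
  - by rewrite disj_set2E; apply/eqP; rewrite -subset0 => x /= []; rewrite !in_itv /=; lra.
have le1 : (\int[mu]_(t in `]0%R, 1%R]) (f t)%:E <= ((1 - q)^-1)%:E)%E.
  have := integral_powRN_le ltr01; rewrite powR1 mul1r; apply: le_trans.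
  rewrite -integral_itv_obnd_cbnd; last exact: measurable_powRN.
  apply: ge0_le_integral => //.
  - by move=> x _; rewrite lee_fin.
  - exact: mf.
  - exact: measurable_powRN.
  - move=> x /=; rewrite in_itv /= => /andP[x0 _]; rewrite lee_fin fE.
    by rewrite ler_piMr ?powR_ge0 // -expR0 ler_expR oppr_le0 ltW.
have le2 : (\int[mu]_(t in `]1%R, +oo[) (f t)%:E <= 1)%E.
  rewrite -(integral_exponential_pdf (@ltr01 R)).
  apply: (@le_trans _ _ (\int[mu]_(t in `]1%R, +oo[) (exponential_pdf 1 t)%:E)%E).
    apply: ge0_le_integral => //.
    - by move=> x _; rewrite lee_fin.
    - exact: mf.
    - by apply/measurable_EFinP; apply: measurable_funTS; exact: measurable_exponential_pdf.
    - move=> x /=; rewrite in_itv /= andbT => x1; rewrite lee_fin fE.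
      rewrite exponential_pdfE ?mul1r ?mulN1r; last by rewrite (le_trans ler01) // ltW.
      rewrite ler_piMl ?expR_ge0 //.
      by rewrite -(powRr0 x) ler_powR ?oppr_le0 // ltW.
  apply: ge0_subset_integral => //.
  - by apply/measurable_EFinP; exact: measurable_exponential_pdf.
  - by move=> x _; rewrite lee_fin exponential_pdf_ge0.
have ge1 : ((expR (- 1))%:E <= \int[mu]_(t in `]0%R, 1%R]) (f t)%:E)%E.
  have -> : (expR (- 1))%:E = (\int[mu]_(t in `]0%R, 1%R]) (cst (expR (-1))%:E t))%E.
    rewrite integral_cst //=.
    by rewrite lebesgue_measure_itv /= lte_fin ltr01 -EFinB subr0 mule1.
  apply: ge0_le_integral => //.
  - by move=> x _; rewrite lee_fin expR_ge0.
  - exact: mf.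
  - move=> x /=; rewrite in_itv /= => /andP[x0 x1]; rewrite lee_fin fE.
    rewrite -[leLHS]mul1r ler_pM ?expR_ge0 // ?ler_expR ?lerN2 //.
    by rewrite -(powRr0 x) ger_powR ?x0 // oppr_le0 ltW.
have ge0 : (0 <= \int[mu]_(t in `]1%R, +oo[) (f t)%:E)%E.
  by apply: integral_ge0 => x _; rewrite lee_fin.
rewrite /Gamma /Rintegral -/f fine_gt0 // split; apply/andP; split.
  by rewrite (lt_le_trans _ (leeDl _ ge0)) // (lt_le_trans _ ge1) // lte_fin expR_gt0.
by apply: (le_lt_trans (leeD le1 le2)); rewrite -EFinD ltry.
Qed.

End PowerIntegrals.

Section PolyBound.
Context {R : realType}.

Lemma poly_bounded01 (e : {poly R}) :
  exists C, 0 <= C /\ forall x, 0 <= x <= 1 -> `|e.[x]| <= C.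
Proof.
exists (\sum_(i < size e) `|e`_i|); split; first by apply: sumr_ge0.
move=> x /andP[x0 x1]; rewrite horner_coef.
apply: (le_trans (ler_norm_sum _ _ _)); apply: ler_sum => i _.
by rewrite normrM ler_piMr // ger0_norm ?exprn_ge0 // exprn_ile1.
Qed.

(** Used to discard errors of order 1 / n in the Abel summation and in the tail estimate near s =
    1. *)
Lemma ge0_le_inv_nat (x c : R) : (forall n, - (c / n.+1%:R) <= x) -> 0 <= x.
Proof.
move=> h; have [//|x0] := leP 0 x; exfalso.
have c0 : 0 < c.
  by have := le_lt_trans (h 0%N) x0; rewrite divr1 oppr_lt0.
have x1 : 0 < - x by rewrite oppr_gt0.
have [n hn] := ltr_add_invr (divr_gt0 x1 c0).
have := h n; rewrite leNgt ltrNr => /negP; apply.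
by move: hn; rewrite add0r ltr_pdivlMr // mulrC.
Qed.

End PolyBound.

(** * The kernel (1 - s^(1/q))^(-q) and its moments *)

Section CaputoKernel.
Context {R : realType} (q : R).
Hypotheses (q_gt0 : 0 < q) (q_lt1 : q < 1).
Local Notation mu := (@lebesgue_measure R).

Definition caputo_kernel (s : R) : R := (1 - s `^ q^-1) `^ (- q).
Local Notation ck := caputo_kernel.

Let qV_gt0 : 0 < q^-1. Proof. by rewrite invr_gt0. Qed.

Lemma powRN_anti (x y : R) : 0 < x -> x <= y -> y `^ (- q) <= x `^ (- q).
Proof.
move=> x0 xy; have y0 := lt_le_trans x0 xy.
rewrite !powRN lef_pV2 ?posrE ?powR_gt0 //.
by rewrite ge0_ler_powR ?nnegrE // ltW.
Qed.

Lemma powR_qV_lt1 (s : R) : 0 <= s < 1 -> s `^ q^-1 < 1.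
Proof.
move=> /andP[s0 s1].
have := @gt0_ltr_powR R _ qV_gt0 s 1; rewrite powR1; apply=> //.
by rewrite nnegrE.
Qed.

Lemma powR_qV_le (s : R) : 0 <= s <= 1 -> s `^ q^-1 <= s.
Proof.
rewrite le_eqVlt => /andP[/orP[/eqP <-|s0] s1]; first by rewrite powR0 ?gt_eqF.
by rewrite ge1r_powR ?s0 // -[leLHS]invr1 lef_pV2 ?posrE // ltW.
Qed.

Lemma caputo_kernel_ge0 s : 0 <= ck s. Proof. exact: powR_ge0. Qed.

Lemma caputo_kernel0 : ck 0 = 1.
Proof. by rewrite /ck powR0 ?gt_eqF // subr0 powR1. Qed.

(** Monotonicity stops short of t = 1: there the base is 0, and a nonzero power of 0 is 0 by
    convention. *)
Lemma caputo_kernel_homo s t : 0 <= s -> s <= t -> t < 1 -> ck s <= ck t.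
Proof.
move=> s0 st t1; have t0 := le_trans s0 st.
apply: powRN_anti; first by rewrite subr_gt0 powR_qV_lt1 // t0.
by rewrite lerD2l lerN2 ge0_ler_powR ?nnegrE // ltW.
Qed.

Lemma caputo_kernel_le s : 0 <= s <= 1 -> ck s <= (1 - s) `^ (- q).
Proof.
move=> /andP[s0]; rewrite le_eqVlt => /predU1P[->|s1].
  by rewrite /ck powR1 subrr.
apply: powRN_anti; first by rewrite subr_gt0.
by rewrite lerD2l lerN2 powR_qV_le // s0 ltW.
Qed.

Lemma caputo_kernel_unbounded B : exists s, 0 < s < 1 /\ B <= ck s.
Proof.
pose b := Num.max 2 B; have b2 : 2 <= b by rewrite le_max lexx.
have bB : B <= b by rewrite le_max lexx orbT.
have b0 : 0 < b by lra.
(* The witness solves 1 - s^(1/q) = eta, so that the kernel takes the value b exactly; b >= 2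
   ensures eta < 1. *)
pose eta := b `^ (- q^-1).
have eta0 : 0 < eta by rewrite powR_gt0.
have eta1 : eta < 1.
  rewrite /eta powRN invf_lt1 ?powR_gt0 //.
  by have := @gt0_ltr_powR R _ qV_gt0 1 b; rewrite powR1; apply; rewrite ?nnegrE; lra.
exists ((1 - eta) `^ q); split.
  rewrite powR_gt0 ?subr_gt0 //=.
  have := @gt0_ltr_powR R _ q_gt0 (1 - eta) 1; rewrite powR1; apply; rewrite ?nnegrE; lra.
rewrite /ck -powRrM mulfV ?gt_eqF // powRr1 ?subr_ge0 ?(ltW eta1) //.
rewrite opprB addrCA subrr addr0 /eta -powRrM mulrNN mulVf ?gt_eqF //.
by rewrite powRr1 ?(ltW b0).
Qed.

Lemma measurable_caputo_kernel D : measurable_fun D ck.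
Proof.
apply: measurable_funTS; apply: (@measurableT_comp _ _ _ _ _ _ (@powR R ^~ (- q))) => //.
by apply: measurable_funB => //; exact: measurable_powR.
Qed.

Lemma integral_caputo_kernel_tail b : 0 <= b -> b < 1 ->
  (\int[mu]_(s in `[b, 1%R]) (ck s)%:E <= ((1 - b) `^ (1 - q) / (1 - q))%:E)%E.
Proof.
move=> b0 b1; have b1' : 0 < 1 - b by rewrite subr_gt0.
apply: le_trans (integral_powRN_le q_lt1 b1').
rewrite [leRHS](@ge0_integral_affine R 1 (-1)) ?oppr_eq0 ?oner_eq0 //; first last.
- by move=> x _; rewrite lee_fin powR_ge0.
- exact: measurable_powRN.
have -> : [set s : R | `[0, 1 - b]%classic (1 + -1 * s)] = `[b, 1]%classic.
  by apply/seteqP; split=> x /=; rewrite !in_itv /= => /andP[? ?]; apply/andP; split; lra.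
rewrite normrN1 mul1e; apply: ge0_le_integral => //.
- by move=> x _; rewrite lee_fin caputo_kernel_ge0.
- by apply/measurable_EFinP; exact: measurable_caputo_kernel.
- apply/measurable_EFinP; apply: measurable_funTS.
  apply: (@measurableT_comp _ _ _ _ _ _ (@powR R ^~ (- q))) => //.
  by apply: measurable_funD => //; exact: measurable_funM.
- move=> x /=; rewrite in_itv /= => /andP[bx x1]; rewrite lee_fin mulN1r.
  by rewrite caputo_kernel_le // x1 (le_trans b0).
Qed.

Lemma integrable_caputo_kernel : mu.-integrable `[0, 1] (EFin \o ck).
Proof.
apply/integrableP; split; first by apply/measurable_EFinP; exact: measurable_caputo_kernel.
under eq_integral do rewrite /= ger0_norm ?caputo_kernel_ge0 //.
by apply: le_lt_trans (integral_caputo_kernel_tail (lexx 0) ltr01) _; rewrite ltry.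
Qed.

Lemma integrable_caputo_kernelM (e : {poly R}) a b : 0 <= a -> b <= 1 ->
  mu.-integrable `[a, b] (EFin \o (fun s => ck s * e.[s])).
Proof.
move=> a0 b1; have [C [C0 hC]] := poly_bounded01 e.
suff i01 : mu.-integrable `[0, 1] (EFin \o (fun s => ck s * e.[s])).
  by apply: integrableS i01 => //; apply: subset_itvScc; rewrite bnd_simp.
have i0 : mu.-integrable `[0, 1] (fun s => C%:E * (EFin \o ck) s)%E.
  by apply: integrableZl => //; exact: integrable_caputo_kernel.
apply: (le_integrable _ _ _ i0) => //.
- apply/measurable_EFinP; apply: measurable_funM; first exact: measurable_caputo_kernel.
  by apply: measurable_funTS; apply: continuous_measurable_fun; exact: continuous_horner.
- move=> x /=; rewrite in_itv /= => x01; rewrite lee_fin normrM.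
  rewrite (normrM C) mulrC ler_wpM2r // (le_trans (hC _ x01)) //.
  by rewrite ger0_norm.
Qed.

Definition caputo_moment (e : {poly R}) : R :=
  Rintegral mu `[0, 1] (fun s => ck s * e.[s]).

Lemma caputo_moment_linear : linear caputo_moment.
Proof.
move=> a e f; rewrite /caputo_moment -[a *: Rintegral _ _ _]/(a * _) -RintegralZl //;
  last exact: integrable_caputo_kernelM.
rewrite -RintegralD //; last 2 first.
- apply: eq_integrable (integrable_caputo_kernelM (a *: e) (lexx 0) (lexx 1)) => // x _.
  by rewrite /= hornerZ mulrCA.
- exact: integrable_caputo_kernelM.
by apply: eq_Rintegral => x _; rewrite hornerD hornerZ mulrDr mulrCA.
Qed.

Lemma caputo_moment_sum n (c : 'I_n -> R) (e : 'I_n -> {poly R}) :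
  caputo_moment (\sum_(i < n) c i *: e i) = \sum_(i < n) c i * caputo_moment (e i).
Proof.
apply: (big_rec2 (fun x y => caputo_moment x = y)) => [|i x y _ <-].
  have := caputo_moment_linear (-1) 0 0.
  by rewrite scaler0 addr0 scaleN1r => h; lra.
exact: caputo_moment_linear.
Qed.

Lemma Rintegral_split (f : R -> R) a b c : a <= b -> b <= c ->
  mu.-integrable `[a, c] (EFin \o f) ->
  Rintegral mu `[a, c] f = Rintegral mu `[a, b] f + Rintegral mu `[b, c] f.
Proof.
move=> ab bc intf; have := Rintegral_itvB intf; move=> /(_ b); rewrite !bnd_simp => h.
rewrite -[LHS](subrK (Rintegral mu `[a, b] f)) h // addrC Rintegral_itv_obnd_cbnd //.
by apply: integrableS intf => //; apply: subset_itv; rewrite bnd_simp.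
Qed.

(** For freezing the kernel at the left end of a cell: ka, kx, kb are its values at the left end, at
    a point and at the right end, and y is the value of the integrand. *)
Lemma abel_cell_lower (ka kx kb y C : R) : ka <= kx -> kx <= kb -> 0 <= C ->
  - C <= y -> - (C * (kb - ka)) <= kx * y - ka * y.
Proof.
move=> k1 k2 C0 yC.
have : 0 <= (kx - ka) * (y + C) by apply: mulr_ge0; lra.
have : 0 <= (kb - kx) * C by apply: mulr_ge0; lra.
lra.
Qed.

Lemma abel_defect_lower (C h ka kb Ea Eb m I : R) :
  - (C * (kb - ka)) * h <= I - ka * (Ea - Eb) -> 0 <= kb - ka -> m <= Eb ->
  - (C * h * (kb - ka)) <= I - (ka * Ea - kb * Eb + (kb - ka) * m).
Proof.
move=> low kab mE; have : 0 <= (kb - ka) * (Eb - m) by apply: mulr_ge0; lra.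
lra.
Qed.

Lemma abel_defect_split (I1 I2 ka kb kc Ea Eb Ec m : R) :
  I1 + I2 - (ka * Ea - kc * Ec + (kc - ka) * m) =
  I1 - (ka * Ea - kb * Eb + (kb - ka) * m) +
  (I2 - (kb * Eb - kc * Ec + (kc - kb) * m)).
Proof. by ring. Qed.

Lemma abel_defect_add (C h ka kb kc D1 D2 : R) :
  - (C * h * (kc - kb)) <= D2 -> - (C * h * (kb - ka)) <= D1 ->
  - (C * h * (kc - ka)) <= D1 + D2.
Proof. lra. Qed.

(** * Integration by parts against the increasing kernel *)

Section AbelSummation.
Variable e : {poly R}.
Let E s := (prim e).[1] - (prim e).[s].
Let I a b := Rintegral mu `[a, b] (fun s => ck s * e.[s]).
(** E is a primitive of -e, so parts would give [I a b] as the boundary terms plus the Stieltjes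
    integral of E against the kernel. The defect compares [I a b] with that expression after E has
    been replaced by m in the Stieltjes integral. *)
Let defect m a b := I a b - (ck a * E a - ck b * E b + (ck b - ck a) * m).

Let defectD m a b c : 0 <= a -> a <= b -> b <= c -> c <= 1 ->
  defect m a c = defect m a b + defect m b c.
Proof.
move=> a0 ab bc c1; rewrite /defect {1}/I (Rintegral_split ab bc); last first.
  exact: integrable_caputo_kernelM.
rewrite -/(I a b) -/(I b c).
exact: abel_defect_split.
Qed.

(** Freezing the kernel at the left end costs at most C (b - a) times its increase over the cell;
    what remains is (ck b - ck a) (E b - m), which is nonnegative. *)
Let defect_cell C m a b : 0 <= a -> a <= b -> b < 1 -> 0 <= C ->
  (forall x, 0 <= x <= 1 -> `|e.[x]| <= C) -> m <= E b ->
  - (C * (b - a) * (ck b - ck a)) <= defect m a b.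
Proof.
move=> a0 ab b1 C0 hC mE.
have kab : 0 <= ck b - ck a by rewrite subr_ge0 caputo_kernel_homo.
have ie : mu.-integrable `[a, b] (EFin \o (fun s => ck a * e.[s])).
  apply: eq_integrable (integrable_horner (ck a *: e) a b) => // x _.
  by rewrite /= hornerZ.
have low : - (C * (ck b - ck a)) * (b - a) <= I a b - ck a * (E a - E b).
  have -> : ck a * (E a - E b) = Rintegral mu `[a, b] (fun s => ck a * e.[s]).
    rewrite RintegralZl //; last exact: integrable_horner.
    by rewrite Rintegral_prim // /E; ring.
  have iab := integrable_caputo_kernelM e a0 (ltW b1).
  have hB := RintegralB _ iab ie.
  rewrite /I -hB //.
  have -> : - (C * (ck b - ck a)) * (b - a) =
      Rintegral mu `[a, b] (fun=> - (C * (ck b - ck a))).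
    rewrite Rintegral_cst //= lebesgue_measure_itv /= lte_fin.
    by case: ltgtP ab => //= -> _; rewrite [b - b]subrr.
  apply: le_Rintegral => //.
  - apply: eq_integrable (integrable_horner (- (C * (ck b - ck a)))%:P a b) => // x _.
    by rewrite /= hornerC.
  - exact: (integrableB _ iab ie).
  move=> x /=; rewrite in_itv /= => /andP[ax xb].
  have := hC x; rewrite (le_trans a0 ax) (le_trans xb (ltW b1)) => /(_ isT).
  rewrite ler_norml => /andP[h1 h2].
  have k1 : ck a <= ck x by rewrite caputo_kernel_homo // (le_lt_trans xb).
  have k2 : ck x <= ck b by rewrite caputo_kernel_homo // (le_trans a0).
  exact: abel_cell_lower k1 k2 C0 h1.
exact: abel_defect_lower low kab mE.
Qed.

(** On cells of equal length h, the errors of [defect_cell] telescope to C h (ck b - ck a), which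
    tends to 0 with h. The kernel is never differentiated. *)
Lemma caputo_abel m a b : 0 <= a -> a <= b -> b < 1 ->
  (forall s, a <= s <= b -> m <= E s) ->
  ck a * E a - ck b * E b + (ck b - ck a) * m <= I a b.
Proof.
move=> a0 ab b1 mE; rewrite -subr_ge0 -/(defect m a b).
have [C [C0 hC]] := poly_bounded01 e.
apply: (@ge0_le_inv_nat _ _ (C * (b - a) * (ck b - ck a))) => n.
pose h := (b - a) / n.+1%:R.
have h0 : 0 <= h by rewrite divr_ge0 ?subr_ge0.
have step i : (i <= n.+1)%N -> a + i%:R * h <= b.
  move=> il; rewrite -lerBrDl /h mulrA ler_pdivrMr ?ltr0n // mulrC.
  by rewrite ler_wpM2l ?subr_ge0 // ler_nat.
have main i : (i <= n.+1)%N ->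
    - (C * h * (ck (a + i%:R * h) - ck a)) <= defect m a (a + i%:R * h).
  elim: i => [_|i IH il].
    have -> : a + 0%:R * h = a by rewrite mulr0n mul0r addr0.
    rewrite subrr mulr0 oppr0 /defect /I set_itv1 Rintegral_set1.
    by rewrite !subrr mul0r addr0 subrr.
  have e1 : a + i.+1%:R * h = a + i%:R * h + h by rewrite -natr1; ring.
  have ai : a <= a + i%:R * h by rewrite lerDl mulr_ge0.
  have le1 : a + i%:R * h <= a + i.+1%:R * h by rewrite e1 lerDl.
  have lb := step _ il.
  rewrite (@defectD m a (a + i%:R * h)) ?(le_trans lb (ltW b1)) //.
  have := IH (ltnW il).
  have := @defect_cell C m (a + i%:R * h) (a + i.+1%:R * h) (le_trans a0 ai) le1
    (le_lt_trans lb b1) C0 hC (mE _ _).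
  rewrite (le_trans ai le1) lb => /(_ isT); rewrite {1}e1 (addrC _ h) addrK.
  exact: abel_defect_add.
have := main n.+1 (leqnn _).
have -> : a + n.+1%:R * h = b by rewrite /h mulrC divfK ?pnatr_eq0 // addrC subrK.
rewrite /h; apply: le_trans; rewrite lerN2 -!mulrA.
by do 2 rewrite ler_wpM2l ?subr_ge0 //; rewrite mulrC.
Qed.

End AbelSummation.
End CaputoKernel.

Section CaputoPoly.
Context {R : realType} (q : R).
Hypotheses (q_gt0 : 0 < q) (q_lt1 : q < 1).
Local Notation mu := (@lebesgue_measure R).
Local Notation ck := (caputo_kernel q).
Local Notation A := (caputo_moment q).

Let q1_gt0 : 0 < 1 - q. Proof. by rewrite subr_gt0. Qed.

Lemma prim_diff_le (e : {poly R}) C a b : a <= b ->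
  (forall x, a <= x <= b -> e.[x] <= C) ->
  (prim e).[b] - (prim e).[a] <= C * (b - a).
Proof.
move=> ab h.
have eC : prim C%:P = C *: 'X.
  have := prim_deriv (C *: 'X); rewrite derivZ derivX alg_polyC => ->.
  by rewrite !hornerE subr0.
have := @prim_homo R (C%:P - e) a b ab.
have -> : prim (C%:P - e) = prim C%:P - prim e.
  by rewrite primD -scaleN1r primZ scaleN1r.
rewrite eC !hornerE => hh.
suff : C * a - (prim e).[a] <= C * b - (prim e).[b] by lra.
by apply: hh => x xab; rewrite !hornerE subr_ge0 h.
Qed.

Lemma caputo_tail_small (c s : R) : s < 1 -> 0 < c ->
  exists b, [/\ s <= b, 0 <= b, b < 1 & (1 - b) `^ (1 - q) / (1 - q) <= c].
Proof.
move=> s1 c0; pose d := (c * (1 - q)) `^ (1 - q)^-1.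
have d0 : 0 < d by rewrite powR_gt0 // mulr_gt0.
pose x := Num.min d (Num.min 1 (1 - s)).
have x0 : 0 < x by rewrite !lt_min d0 ltr01 subr_gt0.
have xd : x <= d by rewrite ge_min lexx.
have x1 : x <= 1 by rewrite !ge_min lexx orbT.
have xs : x <= 1 - s by rewrite !ge_min lexx !orbT.
exists (1 - x); split; try lra.
rewrite subKr ler_pdivrMr //.
have <- : d `^ (1 - q) = c * (1 - q).
  by rewrite /d -powRrM mulVf ?gt_eqF // powRr1 // ltW // mulr_gt0.
by rewrite ge0_ler_powR ?nnegrE // ltW.
Qed.

Lemma abel_lower_sum (I1 I2 I3 P X Y Z Bm km : R) :
  P - X + km <= I1 -> X - Y <= I2 -> - Z <= I3 -> Y <= Z -> Bm <= km ->
  - (2 * Z) <= I1 + I2 + I3 - (P + Bm).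
Proof. lra. Qed.

(** On [0, s0] the kernel grows from 1 to at least B + 1, which yields B m; on [s0, b] only the sign
    of the tail of e is used; [b, 1] contributes a vanishing error. The point s0 depends on B alone,
    hence may be fixed before e. *)
Lemma caputo_moment_lower B : exists s0, 0 < s0 < 1 /\
  forall (e : {poly R}) m,
    (forall s, 0 <= s <= 1 -> 0 <= (prim e).[1] - (prim e).[s]) -> 0 <= m ->
    (forall s, 0 <= s <= s0 -> m <= (prim e).[1] - (prim e).[s]) ->
  (prim e).[1] + B * m <= A e.
Proof.
have [s0 [/andP[s00 s01] kB]] := caputo_kernel_unbounded q_gt0 (B + 1).
exists s0; split; first by rewrite s00.
move=> e m E0 m0 Em.
have [C [C0 hC]] := poly_bounded01 e.
rewrite -subr_ge0; apply: (@ge0_le_inv_nat _ _ (2 * C)) => n.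
have n0 : 0 < n.+1%:R^-1 :> R by rewrite invr_gt0 ltr0n.
have [b [sb b0 b1 tb]] := caputo_tail_small s01 n0.
have tail0 : Rintegral mu `[b, 1] ck <= n.+1%:R^-1.
  have := integral_caputo_kernel_tail q_gt0 q_lt1 b0 b1 => ht.
  apply: le_trans tb; rewrite -lee_fin fineK //.
  rewrite ge0_fin_numE; first exact: le_lt_trans ht (ltry _).
  by apply: integral_ge0 => x _; rewrite lee_fin caputo_kernel_ge0.
have ik : mu.-integrable `[b, 1] (EFin \o ck).
  apply: integrableS (integrable_caputo_kernel q_gt0 q_lt1) => //.
  by apply: subset_itvScc; rewrite bnd_simp.
have tail : - (C * n.+1%:R^-1) <= Rintegral mu `[b, 1] (fun s => ck s * e.[s]).
  apply: (@le_trans _ _ (Rintegral mu `[b, 1] (fun s => - C * ck s))).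
    by rewrite RintegralZl // mulNr lerN2 ler_wpM2l.
  apply: le_Rintegral => //.
  - by apply: eq_integrable (integrableZl _ (- C) ik).
  - exact: integrable_caputo_kernelM.
  move=> x /=; rewrite in_itv /= => /andP[bx x1].
  have := hC x; rewrite (le_trans b0 bx) x1 => /(_ isT).
  rewrite ler_norml => /andP[h1 h2].
  by rewrite [leLHS]mulrC; exact: (ler_wpM2l (caputo_kernel_ge0 _ _) h1).
(* The tail of e at b is at most C (1 - b), which beats the singularity (1 - b)^(-q) of the
   kernel. *)
have bdry : ck b * ((prim e).[1] - (prim e).[b]) <= C * n.+1%:R^-1.
  have h : (prim e).[1] - (prim e).[b] <= C * (1 - b).
    apply: prim_diff_le => [|x /andP[bx x1]]; first exact: ltW.
    by rewrite (le_trans (ler_norm _)) // hC // x1 (le_trans b0).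
  apply: (le_trans (ler_wpM2l (caputo_kernel_ge0 _ _) h)).
  rewrite mulrCA ler_wpM2l // (le_trans _ tb) //.
  have kb : ck b <= (1 - b) `^ (- q) by rewrite caputo_kernel_le // b0 ltW.
  have b1' : 0 < 1 - b by rewrite subr_gt0.
  apply: (@le_trans _ _ ((1 - b) `^ (1 - q))).
    rewrite powRD ?(gt_eqF b1') ?implybT // powRr1 ?(ltW b1') // mulrC.
    by rewrite ler_wpM2l ?(ltW b1').
  by rewrite ler_pdivlMr // ler_piMr ?powR_ge0 // gerBl ltW.
have i01 a c : 0 <= a -> c <= 1 ->
    mu.-integrable `[a, c] (EFin \o (fun s => ck s * e.[s])).
  exact: integrable_caputo_kernelM.
rewrite /caputo_moment (@Rintegral_split R _ 0 b 1) ?(ltW b1) //; last exact: i01.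
rewrite (@Rintegral_split R _ 0 s0 b) ?(ltW s00) //; last by apply: i01 => //; exact: ltW.
have p1 := @caputo_abel R q q_gt0 q_lt1 e m 0 s0 (lexx 0) (ltW s00) s01 Em.
have p2 := @caputo_abel R q q_gt0 q_lt1 e 0 s0 b (ltW s00) sb b1.
rewrite mulr0 addr0 in p2.
move: p1; rewrite caputo_kernel0 // prim0 subr0 mul1r => p1.
have {}p2 : ck s0 * ((prim e).[1] - (prim e).[s0]) - ck b * ((prim e).[1] - (prim e).[b])
    <= Rintegral mu `[s0, b] (fun s => ck s * e.[s]).
  apply: p2 => s /andP[ss sb']; apply: E0.
  by rewrite (le_trans (ltW s00) ss) (le_trans sb' (ltW b1)).
have : B * m <= (ck s0 - 1) * m by rewrite ler_wpM2r // lerBrDr.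
rewrite -mulrA => hB; exact: abel_lower_sum p1 p2 tail bdry hB.
Qed.

End CaputoPoly.

(** The change of variables holds for the positive and negative parts separately; integrability
    makes both finite, so that their difference can be scaled. *)
Lemma Rintegral_scale (R : realType) (v : R) (f : R -> R) : 0 < v ->
  measurable_fun `[0, v] f ->
  (@lebesgue_measure R).-integrable `[0, 1] (EFin \o (fun s => f (v * s))) ->
  Rintegral (@lebesgue_measure R) `[0, v] f =
  v * Rintegral (@lebesgue_measure R) `[0, 1] (fun s => f (v * s)).
Proof.
move=> v0 mf intf; pose g := EFin \o (fun s => f (v * s)).
have setE : [set s : R | `[0, v]%classic (0 + v * s)] = `[0, 1]%classic.
  apply/seteqP; split=> x /=; rewrite !in_itv /= add0r => /andP[h1 h2]; apply/andP; split.
  - by rewrite -(pmulr_rge0 _ v0).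
  - by rewrite -(ler_pM2l v0) mulr1.
  - by rewrite pmulr_rge0.
  - by rewrite -[leRHS]mulr1 ler_pM2l.
have mF : measurable_fun `[0, v] (EFin \o f) by exact/measurable_EFinP.
have hp : (\int[lebesgue_measure]_(x in `[0%R, v]) ((EFin \o f)^\+ x) =
    v%:E * \int[lebesgue_measure]_(x in `[0%R, 1%R]) (g^\+ x))%E.
  rewrite (ge0_integral_affine 0 (lt0r_neq0 v0) _ (measurable_funepos mF)) // setE.
  rewrite gtr0_norm //; congr (_ * _)%E; apply: eq_integral => x _.
  by rewrite !funeposE /g /= add0r.
have hn : (\int[lebesgue_measure]_(x in `[0%R, v]) ((EFin \o f)^\- x) =
    v%:E * \int[lebesgue_measure]_(x in `[0%R, 1%R]) (g^\- x))%E.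
  rewrite (ge0_integral_affine 0 (lt0r_neq0 v0) _ (measurable_funeneg mF)) // setE.
  rewrite gtr0_norm //; congr (_ * _)%E; apply: eq_integral => x _.
  by rewrite !funenegE /g /= add0r.
have fp : (\int[lebesgue_measure]_(x in `[0%R, 1%R]) (g^\+ x))%E \is a fin_num.
  exact: integrable_pos_fin_num.
have fn : (\int[lebesgue_measure]_(x in `[0%R, 1%R]) (g^\- x))%E \is a fin_num.
  exact: integrable_neg_fin_num.
have key (a b : \bar R) : a \is a fin_num -> b \is a fin_num ->
    fine (v%:E * a - v%:E * b) = v * fine (a - b)%E.
  move=> fa fb; have ab : (a +? - b)%E by apply: fin_num_adde_defl; rewrite fin_numN.
  by rewrite -(muleBr _ ab) // fineM // fin_numB fa fb.
by rewrite /Rintegral integralE hp hn key //; congr (v * fine _); rewrite [RHS]integralE.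
Qed.

(** * The operator M^q as a map of polynomials *)

Section CaputoPolyOperator.
Context {R : realType} (q : R).
Hypotheses (q_gt0 : 0 < q) (q_lt1 : q < 1).
Local Notation mu := (@lebesgue_measure R).
Local Notation ck := (caputo_kernel q).
Local Notation A := (caputo_moment q).

(** After the substitution w = v s, M^q p(v) is a multiple of the integral of k(s) p'(v s), so each
    X^i in p' is multiplied by the i-th moment of k. *)
Definition caputo_poly (p : {poly R}) : {poly R} :=
  \poly_(i < size p) ((Gamma (1 - q))^-1 * A 'X^i * p^`()`_i).

Lemma coef_caputo_poly p i :
  (caputo_poly p)`_i = (Gamma (1 - q))^-1 * A 'X^i * p^`()`_i.
Proof.
rewrite coef_poly; case: ltnP => // h; rewrite coef_deriv nth_default ?mul0rn ?mulr0 //.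
exact: leq_trans h (leqnSn _).
Qed.

Lemma caputo_poly_linear : linear caputo_poly.
Proof.
move=> a p r; apply/polyP => i.
by rewrite coefD coefZ !coef_caputo_poly derivD derivZ coefD coefZ; ring.
Qed.

HB.instance Definition _ :=
  GRing.isLinear.Build R {poly R} {poly R} _ caputo_poly caputo_poly_linear.

Lemma Mq_poly p v : 0 < v -> Mq q (horner p) v = (caputo_poly p).[v].
Proof.
move=> v0; rewrite /Mq gt_eqF // /Mq_pos.
have scaled s : 0 <= s <= 1 ->
    Mq_integrand q (horner p) v (v * s) = v^-1 * (ck s * (p^`() \Po (v *: 'X)).[s]).
  move=> s01; case/andP: (s01) => s0 s1.
  rewrite /Mq_integrand -derivE horner_comp !hornerE. congr (_ * _).
  rewrite powRM ?(ltW v0) // -{1}[v `^ _]mulr1 -mulrBr.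
  have h : 0 <= 1 - s `^ q^-1.
    by rewrite subr_ge0 (le_trans (powR_qV_le q_gt0 q_lt1 s01)).
  rewrite powRM ?powR_ge0 // -powRrM mulrN mulVf ?gt_eqF //.
  by rewrite powR_inv1 ?ltW.
have mint : measurable_fun `[0, v] (Mq_integrand q (horner p) v).
  apply: measurable_funTS; apply: measurable_funM.
    apply: (@measurableT_comp _ _ _ _ _ _ (@powR R ^~ (- q))) => //.
    by apply: measurable_funB => //; exact: measurable_powR.
  rewrite -derivE; apply: continuous_measurable_fun; exact: continuous_horner.
have ick := integrable_caputo_kernelM q_gt0 q_lt1 (p^`() \Po (v *: 'X)) (lexx 0) (lexx 1).
rewrite Rintegral_scale //; last first.
  apply: eq_integrable (integrableZl _ v^-1 ick) => // s; rewrite inE /= in_itv /= => s01.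
  by rewrite scaled.
have -> : Rintegral mu `[0, 1] (fun s => Mq_integrand q (horner p) v (v * s)) =
    v^-1 * A (p^`() \Po (v *: 'X)).
  rewrite -RintegralZl //; apply: eq_Rintegral => s; rewrite inE /= in_itv /= => s01.
  by rewrite scaled.
rewrite mulVKf ?gt_eqF //.
have -> : p^`() \Po (v *: 'X) = \sum_(i < size p^`()) (p^`()`_i * v ^+ i) *: 'X^i.
  by rewrite comp_polyE; apply: eq_bigr => i _; rewrite exprZn scalerA.
rewrite caputo_moment_sum // mulr_sumr (@horner_coef_wide _ (size p^`())); last first.
  apply/leq_sizeP => j hj; rewrite coef_caputo_poly nth_default ?mulr0 //.
by apply: eq_bigr => i _; rewrite coef_caputo_poly; ring.
Qed.

Lemma caputo_poly_XM t : caputo_poly ('X * t) =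
  \poly_(i < size t) ((Gamma (1 - q))^-1 * A 'X^i * (t`_i *+ i.+1)).
Proof.
apply/polyP => i.
rewrite coef_caputo_poly coef_deriv coefXM /= coef_poly.
by case: ltnP => // h; rewrite nth_default ?mul0rn ?mulr0.
Qed.

(** As a function of s this is the integral over v of r(v) s t(v s). Its derivative is the integral
    of r(v) u'(v s) with u = X t, so pairing M^q u with r becomes a moment of the kernel: Fubini,
    done on coefficients. *)
Definition caputo_form (r t : {poly R}) : {poly R} :=
  \sum_(i < size t) (t`_i * pint (r * 'X^i)) *: 'X^(i.+1).

Lemma pint_caputo_poly r t :
  pint (r * caputo_poly ('X * t)) = (Gamma (1 - q))^-1 * A (caputo_form r t)^`().
Proof.
rewrite caputo_poly_XM poly_def mulr_sumr linear_sum /=.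
have -> : (caputo_form r t)^`() =
    \sum_(i < size t) (t`_i * pint (r * 'X^i) * i.+1%:R) *: 'X^i.
  rewrite /caputo_form raddf_sum /=; apply: eq_bigr => i _.
  by rewrite derivZ derivXn /= -[_ *+ i.+1]scaler_nat scalerA.
rewrite caputo_moment_sum // mulr_sumr; apply: eq_bigr => i _.
by rewrite -scalerAr linearZ /= -[_ *+ i.+1]mulr_natr /GRing.scale /=; ring.
Qed.

Lemma caputo_form_diff r t s :
  (caputo_form r t).[1] - (caputo_form r t).[s] =
  pint (r * (t - s *: (t \Po (s *: 'X)))).
Proof.
have -> : t - s *: (t \Po (s *: 'X)) =
    \sum_(i < size t) (t`_i * (1 - s ^+ i.+1)) *: 'X^i.
  have tE : t = \sum_(i < size t) t`_i *: 'X^i by rewrite -poly_def coefK.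
  rewrite comp_polyE scaler_sumr {1}tE -sumrB; apply: eq_bigr => i _.
  by rewrite exprZn !scalerA -scalerBl exprS; congr (_ *: _); ring.
rewrite /caputo_form !horner_sum -sumrB mulr_sumr linear_sum /=.
apply: eq_bigr => i _; rewrite -scalerAr linearZ /= !hornerE expr1n /GRing.scale /=.
by ring.
Qed.

End CaputoPolyOperator.

(** * The energy inequality *)

Section CaputoEnergy.
Context {R : realType} (q : R).
Hypotheses (q_gt0 : 0 < q) (q_lt1 : q < 1).
Local Notation A := (caputo_moment q).

Lemma expr_small (x : R) : 0 <= x < 1 ->
  exists N, forall n, (N <= n)%N -> x ^+ n <= 1 / 2.
Proof.
move=> /andP[x0 x1].
have := @cvg_expr R x; rewrite ger0_norm // => /(_ x1) /cvgrPdist_le.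
move=> /(_ (1 / 2) ltac:(lra)) [N _ h]; exists N => n Nn.
by have := h n Nn; rewrite /= sub0r normrN ger0_norm ?exprn_ge0.
Qed.

(** The factor kappa_m of M^q X^(m+1) = kappa_m X^m. *)
Definition caputo_coef (m : nat) : R := (Gamma (1 - q))^-1 * A 'X^m * m.+1%:R.

Let Gamma_gt0 : 0 < (Gamma (1 - q))^-1.
Proof. by rewrite invr_gt0 Gamma_onem_gt0. Qed.

Lemma caputo_coefE m :
  caputo_coef m = (Gamma (1 - q))^-1 * A ('X^(m.+1))^`().
Proof.
have -> : ('X^(m.+1))^`() = \sum_(i < 1) m.+1%:R *: 'X^m :> {poly R}.
  by rewrite big_ord1 derivXn scaler_nat.
by rewrite caputo_moment_sum // big_ord1 /caputo_coef -mulrA (mulrC (A _)).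
Qed.

Lemma prim_deriv_diff (p : {poly R}) a b :
  (prim p^`()).[a] - (prim p^`()).[b] = p.[a] - p.[b].
Proof. by rewrite prim_deriv !hornerE; lra. Qed.

Lemma prim_derivXn m : prim ('X^(m.+1))^`() = 'X^(m.+1) :> {poly R}.
Proof. by rewrite prim_deriv hornerXn expr0n subr0. Qed.

Lemma caputo_coef_gt0 m : 0 < caputo_coef m.
Proof.
rewrite caputo_coefE mulr_gt0 //.
have [s0 [/andP[_ s1] h]] := caputo_moment_lower q_gt0 q_lt1 0.
have := h ('X^(m.+1))^`() 0; rewrite prim_derivXn mul0r addr0 hornerXn expr1n.
have E s : 0 <= s <= 1 -> 0 <= 1 - ('X^(m.+1) : {poly R}).[s].
  by move=> /andP[? ?]; rewrite hornerXn subr_ge0 exprn_ile1.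
move=> /(_ E (lexx 0)) g; apply: lt_le_trans ltr01 (g _) => s /andP[h0 h1].
by apply: E; rewrite h0 (le_trans h1 (ltW s1)).
Qed.

(** As m grows, the mass of the derivative of X^(m+1) moves towards s = 1, where the kernel is
    unbounded: its tail 1 - s^(m+1) is at least 1/2 on all of [0, s0] for large m. *)
Lemma caputo_coef_unbounded B : exists N, forall m, (N <= m)%N -> B <= caputo_coef m.
Proof.
pose g := Gamma (1 - q).
have g0 : 0 < g by exact: Gamma_onem_gt0.
have [s0 [/andP[s00 s01] h]] := caputo_moment_lower q_gt0 q_lt1 (2 * (g * B)).
have s0_01 : 0 <= s0 < 1 by rewrite (ltW s00).
have [N hN] := expr_small s0_01.
exists N => m Nm; rewrite caputo_coefE mulrC ler_pdivlMr // mulrC.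
have := h ('X^(m.+1))^`() (1 / 2).
rewrite prim_derivXn hornerXn expr1n.
have E s : 0 <= s <= 1 -> 0 <= 1 - ('X^(m.+1) : {poly R}).[s].
  by move=> /andP[? ?]; rewrite hornerXn subr_ge0 exprn_ile1.
move=> /(_ E ltac:(lra)) H.
have {}H : 1 + 2 * (g * B) * (1 / 2) <= A ('X^(m.+1))^`().
  apply: H => s /andP[a b]; rewrite hornerXn.
  have : s ^+ m.+1 <= s0 ^+ m.+1 by apply: lerXn2r => //; rewrite nnegrE // ltW.
  by have := hN m.+1 (leqW Nm); lra.
by rewrite -/g; lra.
Qed.

(** On [0, 1] it decreases from 2^n to 1 and plays the part of an exponential exp(- n v). *)
Definition weight (n : nat) : {poly R} := (2%:P - 'X) ^+ n.

Lemma horner_weight n v : (weight n).[v] = (2 - v) ^+ n.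
Proof. by rewrite /weight horner_exp !hornerE. Qed.

Lemma weight_ge1 n v : 0 <= v <= 1 -> 1 <= (weight n).[v].
Proof. by move=> /andP[v0 v1]; rewrite horner_weight exprn_ege1 //; lra. Qed.

Lemma weight_le n v : 0 <= v <= 1 -> (weight n).[v] <= 2 ^+ n.
Proof.
by move=> /andP[v0 v1]; rewrite horner_weight lerXn2r // ?nnegrE; lra.
Qed.

Lemma weight_anti n v w : 0 <= v -> v <= w -> w <= 1 ->
  (weight n).[w] <= (weight n).[v].
Proof.
by move=> v0 vw w1; rewrite !horner_weight lerXn2r // ?nnegrE; lra.
Qed.

(** Raised to the power n, this says by how much the weight drops from s v to v; the factor 1 - (1 -
    s) / 2 * (s * v) is the source of the gain for large n. *)
Lemma weight_scale (s v : R) : 0 <= s <= 1 -> 0 <= v <= 1 ->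
  2 - v <= (2 - s * v) * (1 - (1 - s) / 2 * (s * v)).
Proof.
move=> /andP[s0 s1] /andP[v0 v1]; rewrite -subr_ge0.
have -> : (2 - s * v) * (1 - (1 - s) / 2 * (s * v)) - (2 - v) =
  v * (1 - s) ^+ 2 + (1 - s) * (s * v) ^+ 2 / 2 by field.
by rewrite addr_ge0 ?mulr_ge0 ?sqr_ge0 ?subr_ge0 // invr_ge0.
Qed.

(* The dissipation t (t - t_s) dominates half of t^2 - t_s^2, and the decrease
   of the weight makes the integral of the latter positive. *)
Lemma caputo_dissipation n t s : 0 <= s <= 1 ->
  pint (weight n * 'X * t ^+ 2 * (1 - (1%:P - ((1 - s) / 2) *: 'X) ^+ n)) <=
  2 * pint (weight n * ('X * t) * (t - s *: (t \Po (s *: 'X)))).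
Proof.
move=> s01; case/andP: (s01) => s0 s1.
set d := (1 - s) / 2; set ts := s *: (t \Po (s *: 'X)).
pose f := weight n * 'X * t ^+ 2 * (1%:P - d *: 'X) ^+ n.
have d0 : 0 <= d by rewrite /d; lra.
have d1 : d <= 1 / 2 by rewrite /d; lra.
have dv v : 0 <= v <= 1 -> 0 <= 1 - d * v by move=> /andP[? ?]; nra.
have W0 v : 0 <= v <= 1 -> 0 <= (weight n).[v].
  by move=> v01; rewrite (le_trans ler01) // weight_ge1.
(* The integrands are compared at s v by [weight_scale] to the power n; then the part of the
   integral of f over [s, 1] is dropped. *)
have hf : pint (weight n * 'X * ts ^+ 2) <= pint f.
  apply: le_trans (@pint_scale_le R f s s01 _).
    rewrite -linearZ; apply: ler_pint => v v01; case/andP: (v01) => v0 v1.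
    have sv : 0 <= s * v <= 1 by rewrite mulr_ge0 //= mulr_ile1.
    have -> : (weight n * 'X * ts ^+ 2).[v] =
       (s * (s * v) * t.[s * v] ^+ 2) * (2 - v) ^+ n.
      rewrite /ts !(horner_weight, hornerM, hornerX, hornerZ, horner_comp, horner_exp).
      by ring.
    have -> : (s *: (f \Po (s *: 'X))).[v] =
       (s * (s * v) * t.[s * v] ^+ 2) * ((2 - s * v) * (1 - d * (s * v))) ^+ n.
      rewrite /f !(horner_weight, hornerZ, horner_comp, hornerM, hornerX, horner_exp).
      by rewrite hornerD hornerN hornerZ hornerX hornerC exprMn; ring.
    apply: ler_wpM2l; first by rewrite mulr_ge0 ?sqr_ge0 // mulr_ge0 //; case/andP: sv.
    have h := weight_scale s01 v01.
    by apply: lerXn2r => //; rewrite nnegrE; [lra|apply: le_trans h; lra].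
  move=> v v01; rewrite /f !hornerM hornerX horner_weight !horner_exp.
  rewrite hornerD hornerN hornerZ hornerX hornerC -horner_weight.
  case/andP: (v01) => v0 v1.
  by rewrite mulr_ge0 ?exprn_ge0 ?dv // mulr_ge0 ?sqr_ge0 // mulr_ge0 ?W0.
clearbody ts.
have hE : weight n * 'X * t ^+ 2 * (1 - (1%:P - d *: 'X) ^+ n) =
    weight n * 'X * t ^+ 2 - f by rewrite mulrBr mulr1.
rewrite hE linearB /=.
apply: (@le_trans _ _ (pint (weight n * 'X * t ^+ 2) - pint (weight n * 'X * ts ^+ 2))).
  by rewrite lerD2l lerN2.
rewrite -linearB -linearZ; apply: ler_pint => v v01.
rewrite !(hornerM, hornerZ, hornerD, hornerN, hornerX).
move: (W0 v v01) (ts.[v]) (t.[v]) => w0 a b; case/andP: v01 => v0 v1.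
(* This is the difference 2 b (b - a) - (b^2 - a^2), up to the factor W(v) v. *)
have h : 0 <= (weight n).[v] * v * (b - a) ^+ 2 by rewrite mulr_ge0 ?sqr_ge0 // mulr_ge0.
by rewrite -subr_ge0; apply: le_trans h _; rewrite le_eqVlt; apply/orP; left; apply/eqP; ring.
Qed.

Lemma caputo_form_dissipation n t s : 0 <= s <= 1 ->
  pint (weight n * 'X * t ^+ 2 * (1 - (1%:P - ((1 - s) / 2) *: 'X) ^+ n)) <=
  2 * ((caputo_form (weight n * ('X * t)) t).[1] -
       (caputo_form (weight n * ('X * t)) t).[s]).
Proof. by move=> s01; rewrite caputo_form_diff; exact: caputo_dissipation. Qed.

Lemma dissipation_profile (d v : R) n : 0 <= d <= 1 -> 0 <= v <= 1 ->
  0 <= 1 - (1 - d * v) ^+ n.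
Proof.
move=> /andP[d0 d1] /andP[v0 v1]; rewrite subr_ge0 exprn_ile1 //.
  by rewrite subr_ge0 mulr_ile1.
by rewrite gerBl mulr_ge0.
Qed.

Lemma horner_profile n a t (v : R) :
  (weight n * 'X * t ^+ 2 * (1 - (1%:P - a *: 'X) ^+ n)).[v] =
  (2 - v) ^+ n * v * t.[v] ^+ 2 * (1 - (1 - a * v) ^+ n).
Proof.
have -> : (1 : {poly R}) - (1%:P - a *: 'X) ^+ n = 1%:P - (1%:P - a *: 'X) ^+ n by [].
rewrite 3!hornerM hornerX horner_weight horner_exp; congr (_ * _).
by rewrite hornerD hornerN hornerC horner_exp hornerD hornerN hornerZ hornerX hornerC.
Qed.

(** [caputo_moment_lower] applies to the derivative of [caputo_form]: its full tail is the integral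
    of W v t^2, and up to s0 its tail is at least m by the dissipation bound. This leaves the
    pointwise inequality D v <= 1 + 2 D (1 - (1 - d v)^n). *)
Lemma caputo_energy C : exists n, forall t : {poly R},
  C * pint (weight n * ('X * t) ^+ 2) <=
  pint (weight n * ('X * t) * caputo_poly q ('X * t)).
Proof.
pose g := Gamma (1 - q).
have g0 : 0 < g by exact: Gamma_onem_gt0.
pose D := Num.max 1 (g * C).
have D1 : 1 <= D by rewrite le_max lexx.
have DC : g * C <= D by rewrite le_max lexx orbT.
have [s0 [/andP[s00 s01] h]] := caputo_moment_lower q_gt0 q_lt1 (4 * D).
pose d := (1 - s0) / 2.
have d0 : 0 < d by rewrite /d; lra.
have d1 : d <= 1 / 2 by rewrite /d; lra.
have D0 : 0 < D by lra.
have dD : 0 < d / D by rewrite divr_gt0.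
have dD1 : d / D < 1 by rewrite ltr_pdivrMr //; lra.
(* The exponent is chosen so that (1 - d v)^n <= 1/2 as soon as v >= 1 / D. *)
have [n hn] : exists n, (1 - d / D) ^+ n <= 1 / 2.
  have x01 : 0 <= 1 - d / D < 1 by lra.
  by have [N hN] := expr_small x01; exists N; exact: hN.
exists n => t; pose r := weight n * ('X * t).
pose F := caputo_form r t.
pose prof a := weight n * 'X * t ^+ 2 * (1 - (1%:P - a *: 'X) ^+ n).
pose m := pint (prof d) / 2.
have prof_ge0 (a v : R) : 0 <= a <= 1 -> 0 <= v <= 1 -> 0 <= (prof a).[v].
  move=> a01 v01; rewrite horner_profile mulr_ge0 ?dissipation_profile //.
  case/andP: v01 => v0 v1; rewrite mulr_ge0 ?sqr_ge0 // mulr_ge0 // exprn_ge0 //; lra.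
have FE s : 0 <= s <= 1 -> pint (prof ((1 - s) / 2)) / 2 <= (prim F^`()).[1] - (prim F^`()).[s].
  move=> hs; rewrite prim_deriv_diff ler_pdivrMr // [leRHS]mulrC.
  exact: (@caputo_form_dissipation n t s hs).
have half (s : R) : 0 <= s <= 1 -> 0 <= (1 - s) / 2 <= 1 by move=> /andP[? ?]; lra.
have F0 s : 0 <= s <= 1 -> 0 <= (prim F^`()).[1] - (prim F^`()).[s].
  move=> hs; apply: le_trans (FE s hs); rewrite divr_ge0 //.
  by apply: pint_ge0 => v v01; rewrite prof_ge0 ?half.
have m0 : 0 <= m.
  by rewrite divr_ge0 // pint_ge0 // => v v01; rewrite prof_ge0 //; lra.
have Fm s : 0 <= s <= s0 -> m <= (prim F^`()).[1] - (prim F^`()).[s].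
  move=> /andP[sl su]; have s01' : 0 <= s <= 1 by rewrite sl (le_trans su (ltW s01)).
  apply: le_trans (FE s s01'); rewrite ler_pM2r ?invr_gt0 //.
  apply: ler_pint => v v01; rewrite !horner_profile; case/andP: (v01) => v0 v1.
  apply: ler_wpM2l.
    by rewrite mulr_ge0 ?sqr_ge0 // mulr_ge0 // exprn_ge0 //; lra.
  rewrite lerD2l lerN2 lerXn2r ?nnegrE //.
  - by rewrite subr_ge0 mulr_ile1 //; lra.
  - by rewrite subr_ge0 mulr_ile1 //; lra.
  - by rewrite lerD2l lerN2 ler_wpM2r // /d; lra.
have := h F^`() m F0 m0 Fm.
have -> : (prim F^`()).[1] = pint (weight n * 'X * t ^+ 2).
  have F00 : (prim F^`()).[0] = 0 by rewrite prim0.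
  rewrite -[LHS]subr0 -F00 prim_deriv_diff caputo_form_diff scale0r subr0.
  by congr pint; rewrite /r; ring.
have -> : pint (weight n * 'X * t ^+ 2) + 4 * D * m =
    pint (weight n * 'X * t ^+ 2 + (2 * D) *: prof d).
  by rewrite linearD linearZ /= /GRing.scale /= /m; field.
move=> H; rewrite pint_caputo_poly // -/g -/F ler_pdivlMl // mulrA.
apply: le_trans H.
apply: (@le_trans _ _ (D * pint (weight n * ('X * t) ^+ 2))).
  rewrite ler_wpM2r //; apply: pint_ge0 => v /andP[v0 v1].
  by rewrite hornerM horner_weight horner_exp mulr_ge0 ?sqr_ge0 // exprn_ge0 //; lra.
have -> : D * pint (weight n * ('X * t) ^+ 2) = pint (D *: (weight n * ('X * t) ^+ 2)).
  by rewrite linearZ.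
apply: ler_pint => v v01; rewrite hornerD !hornerZ horner_profile.
rewrite !hornerM horner_weight hornerX.
case/andP: (v01) => v0 v1.
have w0 : 0 <= (2 - v) ^+ n by rewrite exprn_ge0 //; lra.
(* For v <= 1 / D the term 1 suffices; beyond, 2 D times at least 1/2 exceeds D v. *)
have P : D * v <= 1 + 2 * D * (1 - (1 - d * v) ^+ n).
  have d01 : 0 <= d <= 1 by lra.
  have pr := dissipation_profile n d01 v01.
  have [small|big] := leP (D * v) 1.
    by apply: le_trans small _; rewrite lerDl mulr_ge0 // mulr_ge0 // ltW.
  have vb : (1 - d * v) ^+ n <= (1 - d / D) ^+ n.
    rewrite lerXn2r ?nnegrE //; first by rewrite subr_ge0 mulr_ile1 //; lra.
      by rewrite subr_ge0 ltW.
    by rewrite lerD2l lerN2 ler_pM2l // -div1r ler_pdivrMr // mulrC ltW.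
  have : D * (1 / 2) <= D * (1 - (1 - d * v) ^+ n) by rewrite ler_pM2l //; lra.
  by have : D * v <= D by [rewrite ler_piMr // ltW]; lra.
have X0 : 0 <= (2 - v) ^+ n * v * t.[v] ^+ 2 by rewrite mulr_ge0 ?sqr_ge0 // mulr_ge0.
have := ler_wpM2l X0 P; move: ((2 - v) ^+ n) ((1 - d * v) ^+ n) (t.[v]) => w e y; lra.
Qed.

End CaputoEnergy.

(** * Polynomial approximation *)

Section Bernstein.
Context {R : realType}.
Implicit Types (phi psi : nat -> R).

(* At x in [0, 1] this is the expectation of phi of a binomial variable with
   parameters n and x, computed by conditioning on the first trial. *)
Fixpoint bernstein (n : nat) phi : {poly R} :=
  if n is m.+1 then
    'X * bernstein m (phi \o succn) + (1%:P - 'X) * bernstein m phi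
  else (phi 0%N)%:P.

Lemma horner_bernsteinS n phi x :
  (bernstein n.+1 phi).[x] =
  x * (bernstein n (phi \o succn)).[x] + (1 - x) * (bernstein n phi).[x].
Proof. by rewrite /= hornerD !hornerM hornerD hornerN hornerX hornerC. Qed.

Lemma size_bernstein n phi : (size (bernstein n phi) <= n.+1)%N.
Proof.
elim: n phi => [|n IH] phi; first exact: size_polyC_leq1.
have s1 : (size (1%:P - 'X : {poly R})%R <= 2)%N.
  rewrite (leq_trans (size_polyD _ _)) // geq_max size_polyN size_polyX.
  by rewrite (leq_trans (size_polyC_leq1 _)).
rewrite /= (leq_trans (size_polyD _ _)) // geq_max; apply/andP; split.
  rewrite (leq_trans (size_polyMleq _ _)) // size_polyX /=; exact: IH.
rewrite (leq_trans (size_polyMleq _ _)) //.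
have := IH phi; lia.
Qed.

Lemma bernsteinD n phi psi a :
  bernstein n (fun i => phi i + a * psi i) = bernstein n phi + a *: bernstein n psi.
Proof.
elim: n phi psi => [|n IH] phi psi; first by rewrite /= polyCD polyCM mul_polyC.
rewrite /= -[(fun i => _) \o succn]/(fun i => (phi \o succn) i + a * (psi \o succn) i).
by rewrite !IH -!mul_polyC; ring.
Qed.

Lemma bernstein_cst n a x : (bernstein n (fun=> a)).[x] = a.
Proof.
elim: n => [|n IH]; first by rewrite hornerC.
by rewrite horner_bernsteinS -[(fun _ => a) \o succn]/(fun=> a) IH; ring.
Qed.

Lemma ler_bernstein n phi psi x : 0 <= x <= 1 ->
  (forall i, (i <= n)%N -> phi i <= psi i) ->
  (bernstein n phi).[x] <= (bernstein n psi).[x].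
Proof.
move=> /andP[x0 x1]; elim: n phi psi => [|n IH] phi psi h.
  by rewrite !hornerC h.
rewrite !horner_bernsteinS lerD // ler_wpM2l ?subr_ge0 // IH // => i hi.
  exact: h.
by rewrite h // (leq_trans hi).
Qed.

(** The second moment about c of a binomial variable, variance plus squared bias; a success in the
    first trial shifts c to c - 1. *)
Lemma bernstein_variance n c x :
  (bernstein n (fun i => (i%:R - c) ^+ 2)).[x] =
  n%:R * (x * (1 - x)) + (n%:R * x - c) ^+ 2.
Proof.
elim: n c => [|n IH] c; first by rewrite hornerC; ring.
rewrite horner_bernsteinS IH.
have -> : (fun i => (i%:R - c) ^+ 2) \o succn = (fun i => (i%:R - (c - 1)) ^+ 2).
  by apply/funext => i /=; rewrite -natr1; ring.
by rewrite IH -natr1; ring.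
Qed.

(** The operator is monotone and preserves constants, so the modulus a + b (x - y)^2 becomes an
    error a plus b times the variance x (1 - x) / n. *)
Lemma bernstein_approx (f : R -> R) (a b : R) n : (0 < n)%N ->
  0 <= b ->
  (forall x y, 0 <= x <= 1 -> 0 <= y <= 1 -> `|f x - f y| <= a + b * (x - y) ^+ 2) ->
  forall x, 0 <= x <= 1 ->
  `|(bernstein n (fun i => f (i%:R / n%:R))).[x] - f x| <= a + b / n%:R.
Proof.
move=> n0 b0 h x x01; have nR : 0 < n%:R :> R by rewrite ltr0n.
have node i : (i <= n)%N -> 0 <= (i%:R / n%:R : R) <= 1.
  by move=> il; rewrite divr_ge0 //= ler_pdivrMr // mul1r ler_nat.
have nE i : (i%:R / n%:R - x) ^+ 2 = n%:R ^- 2 * (i%:R - n%:R * x) ^+ 2.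
  by field; rewrite gt_eqF.
have var : (n%:R ^- 2 * (bernstein n (fun i => (i%:R - n%:R * x) ^+ 2)).[x] : R)
    <= n%:R^-1.
  rewrite bernstein_variance subrr expr0n addr0 expr2 invfM -mulrA mulKf ?gt_eqF //.
  case/andP: x01 => x0 x1; rewrite ler_piMr ?invr_ge0 //.
  by rewrite mulr_ile1 // ?subr_ge0 // gerBl.
rewrite ler_norml; apply/andP; split.
  rewrite lerBrDl.
  have := @ler_bernstein n (fun i => (f x - a) + (- (b * n%:R ^- 2)) * (i%:R - n%:R * x) ^+ 2)
    (fun i => f (i%:R / n%:R)) x x01.
  rewrite bernsteinD hornerD hornerZ bernstein_cst => H.
  apply: le_trans (H _).
    have : b * (n%:R ^- 2 * (bernstein n (fun i => (i%:R - n%:R * x) ^+ 2)).[x])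
       <= b * n%:R^-1 by rewrite ler_wpM2l.
    by lra.
  move=> i il; have := h x (i%:R / n%:R) x01 (node i il).
  rewrite -sqrrN opprB nE ler_norml => /andP[_]; lra.
rewrite lerBlDl.
have := @ler_bernstein n (fun i => f (i%:R / n%:R))
  (fun i => (f x + a) + (b * n%:R ^- 2) * (i%:R - n%:R * x) ^+ 2) x x01.
rewrite bernsteinD hornerD hornerZ bernstein_cst => H.
apply: le_trans (H _) _.
  move=> i il; have := h (i%:R / n%:R) x (node i il) x01.
  rewrite nE ler_norml => /andP[_]; lra.
have : b * (n%:R ^- 2 * (bernstein n (fun i => (i%:R - n%:R * x) ^+ 2)).[x])
   <= b * n%:R^-1 by rewrite ler_wpM2l.
by lra.
Qed.

(** The images of Kronecker deltas form the Bernstein basis; this expansion separates the variables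
    in [bernstein_approx2]. *)
Lemma bernstein_sum n phi x :
  (bernstein n phi).[x] =
  \sum_(i < n.+1) phi i * (bernstein n (fun j => (j == i)%:R)).[x].
Proof.
have E m (ph ps : nat -> R) : (forall i, (i <= m)%N -> ph i = ps i) ->
   (bernstein m ph).[x] = (bernstein m ps).[x].
  elim: m ph ps => [|m IH] ph ps h; first by rewrite /= !hornerC h.
  rewrite !horner_bernsteinS (IH (ph \o succn) (ps \o succn)); last by move=> i hi; exact: (h i.+1).
  by rewrite (IH ph ps) // => i hi; rewrite h // (leq_trans hi).
rewrite (E n phi (fun j => \sum_(i < n.+1) phi i * (j == i)%:R)); last first.
  move=> i il; rewrite (bigD1 (Ordinal (il : (i < n.+1)%N))) //= eqxx mulr1 big1 ?addr0 //.
  move=> j ji; case: eqP => [ij|_]; last by rewrite mulr0.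
  by move: ji; rewrite -val_eqE /= ij eqxx.
elim: n.+1 => [|k IH].
  rewrite big_ord0 -[RHS](bernstein_cst n 0 x); congr (bernstein _ _).[_].
  by apply/funext => j; rewrite big_ord0.
rewrite big_ord_recr /= -IH -hornerZ -hornerD -bernsteinD; congr (bernstein _ _).[_].
by apply/funext => j; rewrite big_ord_recr.
Qed.

(** Approximate first in w, then each coefficient in v. The basis in w is a partition of unity, so
    the second error is not amplified and the total is twice the error in one variable. *)
Lemma bernstein_approx2 (F : R -> R -> R) (a b : R) n : (0 < n)%N -> 0 <= b ->
  (forall v v' w w', 0 <= v <= 1 -> 0 <= v' <= 1 -> 0 <= w <= 1 -> 0 <= w' <= 1 ->
    `|F v w - F v' w'| <= a + b * ((v - v') ^+ 2 + (w - w') ^+ 2)) ->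
  exists Pv Pw : 'I_n.+1 -> {poly R}, forall v w, 0 <= v <= 1 -> 0 <= w <= 1 ->
    `|\sum_i (Pv i).[v] * (Pw i).[w] - F v w| <= 2 * (a + b / n%:R).
Proof.
move=> n0 b0 h; have nR : 0 < n%:R :> R by rewrite ltr0n.
have node (i : 'I_n.+1) : 0 <= (i%:R / n%:R : R) <= 1.
  by rewrite divr_ge0 //= ler_pdivrMr // mul1r ler_nat -ltnS.
exists (fun i : 'I_n.+1 => bernstein n (fun j => F (j%:R / n%:R) (i%:R / n%:R))).
exists (fun i : 'I_n.+1 => bernstein n (fun j => (j == i)%:R)) => v w v01 w01.
have b_ge0 (i : 'I_n.+1) : 0 <= (bernstein n (fun j => (j == i)%:R)).[w].
  rewrite -[leLHS](bernstein_cst n 0 w); exact: ler_bernstein.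
have h1 (i : 'I_n.+1) :
    `|(bernstein n (fun j => F (j%:R / n%:R) (i%:R / n%:R))).[v] - F v (i%:R / n%:R)|
    <= a + b / n%:R.
  apply: (bernstein_approx (f := fun x => F x (i%:R / n%:R))) => // x y x01 y01.
  by have := h x y _ _ x01 y01 (node i) (node i); rewrite subrr expr0n addr0.
have h2 : `|(bernstein n (fun j => F v (j%:R / n%:R))).[w] - F v w| <= a + b / n%:R.
  apply: (bernstein_approx (f := F v)) => // x y x01 y01.
  by have := h v v _ _ v01 v01 x01 y01; rewrite subrr expr0n add0r.
rewrite -(subrKA (bernstein n (fun j => F v (j%:R / n%:R))).[w]).
apply: (le_trans (ler_normD _ _)); rewrite mulr_natl mulr2n; apply: lerD => //.
rewrite bernstein_sum -sumrB; under eq_bigr do rewrite -mulrBl.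
apply: (le_trans (ler_norm_sum _ _ _)).
have -> : a + b / n%:R = \sum_(i < n.+1) (a + b / n%:R) * (bernstein n (fun j => (j == i)%:R)).[w].
  by rewrite -(bernstein_sum n (fun=> a + b / n%:R)) bernstein_cst.
apply: ler_sum => i _; rewrite normrM (ger0_norm (b_ge0 i)).
by rewrite ler_wpM2r.
Qed.

End Bernstein.

Section Modulus.
Context {R : realType}.

(* The bound away from the diagonal is absorbed in the quadratic term. *)
Lemma square_modulus (F : R -> R -> R) (a : R) :
  continuous (fun z : R * R => F z.1 z.2) -> 0 < a ->
  exists b, 0 <= b /\
  forall v v' w w', 0 <= v <= 1 -> 0 <= v' <= 1 -> 0 <= w <= 1 -> 0 <= w' <= 1 ->
    `|F v w - F v' w'| <= a + b * ((v - v') ^+ 2 + (w - w') ^+ 2).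
Proof.
move=> cF a0.
pose S : set (R * R) := `[0, 1] `*` `[0, 1].
have cS : compact (S `*` S).
  by apply: compact_setX; apply: compact_setX; exact: segment_compact.
pose g (p : (R * R) * (R * R)) := `|F p.1.1 p.1.2 - F p.2.1 p.2.2|.
have c1 : continuous (fun p : (R * R) * (R * R) => F p.1.1 p.1.2).
  move=> p; apply: (@continuous_comp _ _ _ (fun p : (R * R) * (R * R) => p.1)
    (fun z : R * R => F z.1 z.2)); [exact: cvg_fst|exact: cF].
have c2 : continuous (fun p : (R * R) * (R * R) => F p.2.1 p.2.2).
  move=> p; apply: (@continuous_comp _ _ _ (fun p : (R * R) * (R * R) => p.2)
    (fun z : R * R => F z.1 z.2)); [exact: cvg_snd|exact: cF].
have cg : continuous g.
  by move=> p; apply: cvg_norm; apply: cvgB; [exact: c1|exact: c2].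
pose dist (p : (R * R) * (R * R)) := (p.1.1 - p.2.1) ^+ 2 + (p.1.2 - p.2.2) ^+ 2.
have cd : continuous dist.
  have sq : continuous (fun x : R => x ^+ 2) by move=> x; exact: exprn_continuous.
  move=> p; apply: cvgD.
    apply: (@continuous_comp _ _ _ (fun p : (R * R) * (R * R) => p.1.1 - p.2.1)
      (fun x : R => x ^+ 2)); last exact: sq.
    apply: cvgB.
      by apply: (@continuous_comp _ _ _ (fun p : (R * R) * (R * R) => p.1) (fun z : R * R => z.1));
        exact: cvg_fst.
    by apply: (@continuous_comp _ _ _ (fun p : (R * R) * (R * R) => p.2) (fun z : R * R => z.1));
      [exact: cvg_snd|exact: cvg_fst].
  apply: (@continuous_comp _ _ _ (fun p : (R * R) * (R * R) => p.1.2 - p.2.2)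
    (fun x : R => x ^+ 2)); last exact: sq.
  apply: cvgB.
    by apply: (@continuous_comp _ _ _ (fun p : (R * R) * (R * R) => p.1) (fun z : R * R => z.2));
      [exact: cvg_fst|exact: cvg_snd].
  by apply: (@continuous_comp _ _ _ (fun p : (R * R) * (R * R) => p.2) (fun z : R * R => z.2));
      exact: cvg_snd.
have inSS (v v' w w' : R) : 0 <= v <= 1 -> 0 <= v' <= 1 -> 0 <= w <= 1 -> 0 <= w' <= 1 ->
    (S `*` S) ((v, w), (v', w')).
  by move=> h1 h2 h3 h4; split; split; rewrite /= in_itv.
have z01 : 0 <= (0 : R) <= 1 by rewrite lexx ler01.
have [M _ hM] : exists2 c, c \in S `*` S & forall t, t \in S `*` S -> g t <= g c.
  apply: compact_EVT_max => //; last exact: continuous_subspaceT.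
  by exists ((0, 0), (0, 0)); exact: inSS.
(* On this compact set the two points are distinct, so their squared distance has a positive
   minimum; b is the maximal oscillation divided by that minimum. *)
pose E := (S `*` S) `&` (g @^-1` [set x | a <= x]).
have cE : compact E.
  by apply: compact_closedI => //; apply: closed_comp; [move=> p _; exact: cg|exact: closed_ge].
have [E0|E0] := pselect (E !=set0); last first.
  exists 0; split=> // v v' w w' h1 h2 h3 h4; rewrite mul0r addr0.
  rewrite leNgt; apply/negP => /ltW h; apply: E0; exists ((v, w), (v', w')).
  by split; [exact: inSS|].
have [c cE' hc] : exists2 c, c \in E & forall t, t \in E -> dist c <= dist t.
  by apply: compact_EVT_min => //; exact: continuous_subspaceT.
have dc : 0 < dist c.
  rewrite lt_neqAle addr_ge0 ?sqr_ge0 // andbT eq_sym.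
  apply/negP => /eqP dc0; move: cE'; rewrite inE => -[_ /=].
  have e1 : c.1.1 = c.2.1.
    by apply/eqP; rewrite -subr_eq0 -sqrf_eq0 eq_le sqr_ge0 andbT -dc0 /dist lerDl sqr_ge0.
  have e2 : c.1.2 = c.2.2.
    by apply/eqP; rewrite -subr_eq0 -sqrf_eq0 eq_le sqr_ge0 andbT -dc0 /dist lerDr sqr_ge0.
  by rewrite /g e1 e2 subrr normr0 leNgt a0.
exists (g M / dist c); split; first by rewrite divr_ge0 ?normr_ge0 // ltW.
move=> v v' w w' h1 h2 h3 h4; pose t := ((v, w), (v', w')).
rewrite -[X in X <= _]/(g t) -[X in _ * X]/(dist t).
have [ga|ga] := leP (g t) a.
  apply: le_trans ga _; rewrite lerDl mulr_ge0 ?divr_ge0 ?normr_ge0 //; first exact: ltW.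
  by rewrite addr_ge0 ?sqr_ge0.
have tE : t \in E by rewrite inE; split; [exact: inSS|exact: ltW].
have gt : g t <= g M by apply: hM; rewrite inE; exact: inSS.
apply: (@le_trans _ _ (g M)) => //.
rewrite -mulrAC ler_wpDl ?(ltW a0) // ler_pdivlMr // ler_wpM2l ?normr_ge0 //.
exact: hc.
Qed.

End Modulus.

(** * Continuity and polynomial approximation of the transformed kernel *)

Section TransformedKernel.
Context {R : realType} (q : R) (K : R -> R -> R).
Hypotheses (q_gt0 : 0 < q) (q_lt1 : q < 1).
Hypothesis K_cont : {within triangle, continuous (fun z : R * R => K z.1 z.2)}.

Definition clamp (x : R) : R := Num.max 0 (Num.min 1 x).

Lemma clamp_id x : 0 <= x <= 1 -> clamp x = x.
Proof. by move=> /andP[x0 x1]; rewrite /clamp min_r // max_r. Qed.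

Lemma clamp_itv x : 0 <= clamp x <= 1.
Proof. by rewrite /clamp le_max lexx /= ge_max ler01 ge_min lexx. Qed.

Lemma continuous_powR_max (r : R) : 0 < r ->
  continuous (fun x : R => Num.max 0 x `^ r).
Proof.
move=> r0 x; have cmax : {for x, continuous (fun x : R => Num.max 0 x)}.
  apply: continuous_max; [exact: cvg_cst|exact: cvg_id].
have [x0|x0] := ltP 0 x.
  apply: (@continuous_comp _ _ _ (fun x : R => Num.max 0 x) (fun t : R => t `^ r)) => //.
  apply: differentiable_continuous; apply/derivable1_diffP; apply: ex_derive.
  by apply: is_derive1_powR; rewrite lt_max x0 orbT.
rewrite /continuous_at (max_l x0) powR0 ?gt_eqF //; apply/cvgrPdist_le => e e0.
have d0 : 0 < e `^ r^-1 by rewrite powR_gt0.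
near=> y.
rewrite sub0r normrN ger0_norm ?powR_ge0 //.
have -> : e = (e `^ r^-1) `^ r by rewrite -powRrM mulVf ?gt_eqF // powRr1 // ltW.
apply: ge0_ler_powR; rewrite ?nnegrE ?le_max ?lexx //; try exact: ltW.
rewrite ge_max (ltW d0) /=; apply/ltW; near: y.
exact: lt_nbhsl (le_lt_trans x0 d0).
Unshelve. all: by end_near. Qed.

Let qV_gt1 : 1 < q^-1. Proof. by rewrite invf_gt1. Qed.
Let qV_gt0 : 0 < q^-1. Proof. by rewrite invr_gt0. Qed.

(** A continuous extension from the triangle to the plane: v is clamped to [0, 1] and w to [0, v],
    so K is evaluated only inside its domain. *)
Definition square_kernel (v w : R) : R :=
  Ktilde q K (clamp v) (Num.min (clamp v) (clamp w)).

Lemma square_kernelE v w : 0 <= w -> w <= v -> v <= 1 ->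
  square_kernel v w = Ktilde q K v w.
Proof.
move=> w0 wv v1; rewrite /square_kernel !clamp_id ?v1 ?w0 ?(le_trans w0 wv) //.
  by rewrite min_r.
by rewrite (le_trans wv).
Qed.

Lemma triangle_powR v w : 0 <= w -> w <= v -> v <= 1 ->
  @triangle R (v `^ q^-1, w `^ q^-1).
Proof.
move=> w0 wv v1; have v0 := le_trans w0 wv; split=> /=.
  by rewrite powR_ge0 /= ge0_ler_powR ?nnegrE // ltW.
have := @ge0_ler_powR R q^-1 (ltW qV_gt0) v 1; rewrite powR1.
by apply=> //; rewrite nnegrE.
Qed.

Lemma continuous_square_kernel : continuous (fun z : R * R => square_kernel z.1 z.2).
Proof.
have cclamp : continuous clamp.
  move=> x; apply: continuous_max; first exact: cvg_cst.
  by apply: continuous_min; [exact: cvg_cst|exact: cvg_id].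
have c1 : continuous (fun z : R * R => clamp z.1).
  by move=> z; apply: (@continuous_comp _ _ _ (fun z : R * R => z.1) clamp);
    [exact: cvg_fst|exact: cclamp].
have c2 : continuous (fun z : R * R => clamp z.2).
  by move=> z; apply: (@continuous_comp _ _ _ (fun z : R * R => z.2) clamp);
    [exact: cvg_snd|exact: cclamp].
pose m (z : R * R) := Num.min (clamp z.1) (clamp z.2).
have cm : continuous m.
  move=> z; exact: (@continuous_min R _ (fun z => clamp z.1) (fun z => clamp z.2) z (c1 z) (c2 z)).
have m0 z : 0 <= m z.
  by rewrite /m le_min; case/andP: (clamp_itv z.1) => ->; case/andP: (clamp_itv z.2) => ->.
have mle z : m z <= clamp z.1 by rewrite /m ge_min lexx.
have cpow (g : R * R -> R) r : 0 < r -> continuous g -> (forall z, 0 <= g z) ->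
    continuous (fun z => g z `^ r).
  move=> r0 cg g0.
  have -> : (fun z => g z `^ r) = (fun x => Num.max 0 x `^ r) \o g.
    by apply/funext => z /=; rewrite max_r.
  move=> z; apply: continuous_comp; [exact: cg|exact: continuous_powR_max].
have cK : continuous (fun z : R * R => K (clamp z.1 `^ q^-1) (m z `^ q^-1)).
  pose G (z : R * R) := (clamp z.1 `^ q^-1, m z `^ q^-1).
  have g1 : continuous (fun z : R * R => clamp z.1 `^ q^-1).
    by apply: (cpow (fun z => clamp z.1)) => // y; case/andP: (clamp_itv y.1).
  have g2 : continuous (fun z => m z `^ q^-1) by exact: (cpow m).
  have cG : continuous G by move=> z; exact: (cvg_pair (g1 z) (g2 z)).
  (* K is continuous only relative to the triangle; since [G] takes its values there, convergence
     along the restricted neighbourhood filter suffices. *)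
  have GT z : triangle (G z).
    by apply: triangle_powR => //; case/andP: (clamp_itv z.1).
  move=> z; move/subspace_continuousP: K_cont => /(_ (G z) (GT z)) h.
  apply: (@cvg_comp _ _ _ G (fun z : R * R => K z.1 z.2) _ (within triangle (nbhs (G z)))) h.
  move=> A hA; have := cG z _ hA; rewrite /nbhs /=.
  by apply: filterS => y /= /(_ (GT y)).
move=> z; rewrite /square_kernel /Ktilde.
apply: cvgM; last exact: cK.
apply: cvgM; last exact: cvg_cst.
by apply: (cpow m) => //; rewrite subr_gt0.
Qed.

Lemma Ktilde_approx (eps : R) : 0 < eps ->
  exists (n : nat) (Pv Pw : 'I_n -> {poly R}),
  forall v w, 0 <= w -> w <= v -> v <= 1 ->
    `|\sum_i (Pv i).[v] * (Pw i).[w] - Ktilde q K v w| <= eps.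
Proof.
(* [bernstein_approx2] returns 2 (a + b / n), so a and b / n get eps / 4 each; b + 1 avoids a
   division by 0. *)
move=> e0; have e4 : 0 < eps / 4 by rewrite divr_gt0.
have [b [b0 hb]] := square_modulus continuous_square_kernel e4.
have e4b : 0 < eps / 4 / (b + 1) by rewrite divr_gt0 // ltr_wpDl.
have [n hn] := ltr_add_invr e4b; rewrite add0r in hn.
have [Pv [Pw h]] := bernstein_approx2 (ltn0Sn n) b0 hb.
exists n.+2, Pv, Pw => v w w0 wv v1.
rewrite -square_kernelE //; apply: le_trans (h v w _ _) _.
- by rewrite (le_trans w0 wv).
- by rewrite w0 (le_trans wv).
have : b / n.+1%:R <= eps / 4.
  move: hn; rewrite ltr_pdivlMr ?ltr_wpDl // => /ltW hn.
  by apply: le_trans hn; rewrite mulrC ler_wpM2l ?invr_ge0 // lerDl.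
by move: (b / n.+1%:R) => y; lra.
Qed.

Lemma Ktilde_bounded : exists M, 0 <= M /\
  forall v w, 0 <= w -> w <= v -> v <= 1 -> `|Ktilde q K v w| <= M.
Proof.
have [b [b0 hb]] := square_modulus continuous_square_kernel (@ltr01 R).
exists (1 + b * 2 + `|square_kernel 0 0|); split.
  by rewrite addr_ge0 // addr_ge0 // mulr_ge0.
move=> v w w0 wv v1; rewrite -square_kernelE //.
have w1 := le_trans wv v1; have v0 := le_trans w0 wv.
rewrite -[square_kernel v w](subrK (square_kernel 0 0)).
apply: (le_trans (ler_normD _ _)); rewrite lerD2r.
have z01 : 0 <= (0 : R) <= 1 by rewrite lexx ler01.
have := hb v 0 w 0; rewrite !subr0 v0 v1 w0 w1 => /(_ isT z01 isT z01) h.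
apply: le_trans h _; rewrite lerD2l ler_wpM2l //.
have : v ^+ 2 <= 1 by rewrite exprn_ile1.
have : w ^+ 2 <= 1 by rewrite exprn_ile1.
lra.
Qed.

End TransformedKernel.

(** * The discrete Volterra operator *)

Section WeightedNorm.
Context {R : realType}.
Implicit Types (p r : {poly R}).

Lemma discriminant_le (a b c : R) : 0 <= a -> 0 <= c ->
  (forall t, 0 <= a + 2 * t * b + t ^+ 2 * c) -> `|b| <= Num.sqrt a * Num.sqrt c.
Proof.
move=> a0 c0 h; suff h2 : b ^+ 2 <= a * c.
  by rewrite -sqrtrM // -sqrtr_sqr ler_wsqrtr.
move: c0; rewrite le_eqVlt => /predU1P[c0|c0].
  have [->|b0] := eqVneq b 0; first by rewrite expr0n -c0 mulr0.
  (* For c = 0 the polynomial in t is affine, and a nonzero b would give it the value -1 at this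
     t. *)
  have := h (- (a + 1) / (2 * b)); rewrite -c0 mulr0 addr0.
  have -> : 2 * (- (a + 1) / (2 * b)) * b = - (a + 1) by field.
  by move=> ?; exfalso; lra.
have := h (- b / c).
have -> : a + 2 * (- b / c) * b + (- b / c) ^+ 2 * c = (a * c - b ^+ 2) / c.
  by field; rewrite gt_eqF.
by rewrite pmulr_lge0 ?invr_gt0 // subr_ge0.
Qed.

Lemma weighted_sum_cs m (f g d : 'I_m -> R) : (forall i, 0 <= d i) ->
  `|\sum_i f i * g i * d i| <=
  Num.sqrt (\sum_i f i ^+ 2 * d i) * Num.sqrt (\sum_i g i ^+ 2 * d i).
Proof.
move=> d0; apply: discriminant_le.
- by apply: sumr_ge0 => i _; rewrite mulr_ge0 ?sqr_ge0.
- by apply: sumr_ge0 => i _; rewrite mulr_ge0 ?sqr_ge0.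
move=> t; rewrite !mulr_sumr -!big_split /=; apply: sumr_ge0 => i _.
have -> : f i ^+ 2 * d i + 2 * t * (f i * g i * d i) + t ^+ 2 * (g i ^+ 2 * d i) =
  (f i + t * g i) ^+ 2 * d i by ring.
by rewrite mulr_ge0 ?sqr_ge0.
Qed.

Lemma horner_weight_sqr n p v :
  (weight n * p ^+ 2).[v] = (weight n).[v] * p.[v] ^+ 2.
Proof. by rewrite hornerM; congr (_ * _); rewrite horner_exp. Qed.

Lemma weight_sqr_ge0 n p v : 0 <= v <= 1 -> 0 <= (weight n * p ^+ 2).[v].
Proof.
move=> v01; rewrite horner_weight_sqr mulr_ge0 ?sqr_ge0 //.
by rewrite (le_trans ler01) // weight_ge1.
Qed.

Lemma pint_weight_sqr_ge0 n p : 0 <= pint (weight n * p ^+ 2).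
Proof. by apply: pint_ge0 => v; exact: weight_sqr_ge0. Qed.

Definition wnorm n p : R := Num.sqrt (pint (weight n * p ^+ 2)).

Lemma wnorm_ge0 n p : 0 <= wnorm n p. Proof. exact: sqrtr_ge0. Qed.

Lemma wnorm_sqr n p : wnorm n p ^+ 2 = pint (weight n * p ^+ 2).
Proof. by rewrite sqr_sqrtr // pint_weight_sqr_ge0. Qed.

Lemma wnorm0_sqr p : wnorm 0 p ^+ 2 = pint (p ^+ 2).
Proof. by rewrite wnorm_sqr /weight expr0 mul1r. Qed.

Lemma wnorm_cs n p r : `|pint (weight n * (p * r))| <= wnorm n p * wnorm n r.
Proof.
apply: discriminant_le; try exact: pint_weight_sqr_ge0.
move=> t; apply: le_trans (pint_weight_sqr_ge0 n (p + t *: r)) _.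
have -> : weight n * (p + t *: r) ^+ 2 = weight n * p ^+ 2 +
   (2 * t) *: (weight n * (p * r)) + (t ^+ 2) *: (weight n * r ^+ 2).
  by rewrite -!mul_polyC !polyCM; ring.
by rewrite !linearD !linearZ.
Qed.

Lemma wnorm_triangle n p r : wnorm n (p + r) <= wnorm n p + wnorm n r.
Proof.
rewrite -(@ler_pXn2r _ 2) ?nnegrE ?addr_ge0 ?wnorm_ge0 //.
rewrite sqrrD !wnorm_sqr.
have -> : weight n * (p + r) ^+ 2 =
  weight n * p ^+ 2 + (weight n * (p * r)) *+ 2 + weight n * r ^+ 2 by ring.
rewrite linearD /= linearD /= linearMn /= lerD2r lerD2l ler_wMn2r //.
exact: le_trans (ler_norm _) (wnorm_cs _ _ _).
Qed.

Lemma wnormZ n a p : wnorm n (a *: p) = `|a| * wnorm n p.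
Proof.
rewrite /wnorm exprZn -scalerAr linearZ /= /GRing.scale /= sqrtrM ?sqr_ge0 //.
by rewrite sqrtr_sqr.
Qed.

Lemma wnormN n p : wnorm n (- p) = wnorm n p.
Proof. by rewrite /wnorm sqrrN. Qed.

Lemma wnorm_eq0 n p : wnorm n p = 0 -> p = 0.
Proof.
move=> h; have := wnorm_sqr n p; rewrite h expr0n => /esym.
move=> /(pint_eq0 (fun v hv => @weight_sqr_ge0 n p v hv)) /eqP.
rewrite mulf_eq0 (expf_eq0 p) /= => /orP[/eqP w0|/eqP //].
have := @weight_ge1 R n 0; rewrite w0 horner0 => /(_ _); rewrite lexx ler01 => /(_ isT).
by rewrite ler10.
Qed.

Lemma wnorm_le_sup n p c : 0 <= c ->
  (forall v, 0 <= v <= 1 -> (weight n).[v] * p.[v] ^+ 2 <= c ^+ 2) -> wnorm n p <= c.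
Proof.
move=> c0 h; rewrite -(@ler_pXn2r _ 2) ?nnegrE ?wnorm_ge0 // wnorm_sqr.
rewrite -[leRHS]pint_C; apply: ler_pint => v v01.
by rewrite horner_weight_sqr hornerC h.
Qed.

Lemma wnorm0_le_sup p c : (forall v, 0 <= v <= 1 -> `|p.[v]| <= c) -> wnorm 0 p <= c.
Proof.
move=> h; have c0 : 0 <= c by rewrite (le_trans _ (h 0 _)) // lexx ler01.
apply: wnorm_le_sup => // v v01.
rewrite /weight expr0 hornerC mul1r -real_normK ?num_real //.
by rewrite lerXn2r ?nnegrE // h.
Qed.

Lemma wnorm0_le n p : wnorm 0 p <= wnorm n p.
Proof.
rewrite /wnorm ler_wsqrtr //; apply: ler_pint => v v01.
rewrite !horner_weight_sqr {1}/weight expr0 hornerC mul1r.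
by rewrite ler_peMl ?weight_ge1 ?sqr_ge0.
Qed.

Lemma wnorm_le n p : wnorm n p <= 2 ^+ n * wnorm 0 p.
Proof.
rewrite -(@ler_pXn2r _ 2) ?nnegrE ?mulr_ge0 ?wnorm_ge0 ?exprn_ge0 //.
rewrite exprMn wnorm0_sqr wnorm_sqr -[_ * pint _]linearZ.
apply: ler_pint => v v01; rewrite horner_weight_sqr hornerZ.
rewrite [(p ^+ 2).[v]]horner_exp ler_wpM2r ?sqr_ge0 //.
rewrite (le_trans (weight_le n v01)) // ler_eXnr // ?exprn_ege1 //; lra.
Qed.

Lemma wnorm0_MX p : wnorm 0 ('X * p) <= wnorm 0 p.
Proof.
rewrite /wnorm ler_wsqrtr //; apply: ler_pint => v /andP[v0 v1].
rewrite /weight expr0 !mul1r !horner_exp hornerM hornerX exprMn.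
by rewrite ler_piMl ?sqr_ge0 // exprn_ile1.
Qed.

End WeightedNorm.

Section QuadratureNorm.
Context {R : realType} (N : nat) (theta delta : 'I_N.+1 -> R).
Hypothesis gauss : legendre_gauss theta delta.

Lemma gauss_sqr (p : {poly R}) : (size p <= N.+1)%N ->
  \sum_k p.[theta k] ^+ 2 * delta k = wnorm 0 p ^+ 2.
Proof.
move=> sp; rewrite wnorm0_sqr -(gauss_exact gauss).
  by apply: eq_bigr => k _; rewrite horner_exp.
rewrite expr2 (leq_trans (size_polyMleq _ _)) //; lia.
Qed.

(** Cauchy-Schwarz for the positive weights: the sum of f^2 is at most rho^2 because the weights add
    up to 1, and the sum of p^2 is exact. *)
Lemma gauss_bound (f : R -> R) rho (p : {poly R}) : (size p <= N.+1)%N ->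
  (forall v, 0 <= v <= 1 -> `|f v| <= rho) ->
  `|\sum_k f (theta k) * p.[theta k] * delta k| <= rho * wnorm 0 p.
Proof.
move=> sp h; have d0 k : 0 <= delta k by exact: ltW (gauss_weight_gt0 gauss k).
have rho0 : 0 <= rho by rewrite (le_trans _ (h 0 _)) // lexx ler01.
apply: (le_trans (weighted_sum_cs (fun k => f (theta k)) (fun k => p.[theta k]) d0)).
rewrite gauss_sqr // sqrtr_sqr (ger0_norm (wnorm_ge0 _ _)).
rewrite ler_wpM2r ?wnorm_ge0 // -[leRHS]ger0_norm // -[leRHS]sqrtr_sqr ler_wsqrtr //.
rewrite -[leRHS]mulr1 -(sum_gauss_weight gauss) mulr_sumr; apply: ler_sum => k _.
rewrite ler_wpM2r // -[leLHS]real_normK ?num_real //.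
by rewrite lerXn2r ?nnegrE // h // (gauss_node_itv gauss).
Qed.

End QuadratureNorm.

Section SeparatedVolterra.
Context {R : realType} (m : nat) (Pv Pw : 'I_m -> {poly R}).
Implicit Types (u : {poly R}).

(** The Volterra operator with separated kernel, the sum over i of Pv_i(v) Pw_i(w). *)
Definition volterra_poly u : {poly R} := \sum_i Pv i * prim (Pw i * u).

Lemma size_comp_scale (p : {poly R}) v : (size (p \Po (v *: 'X))%R <= size p)%N.
Proof.
rewrite comp_polyE; apply: (leq_trans (size_sum _ _ _)); apply/bigmax_leqP => i _.
rewrite exprZn scalerA (leq_trans (size_scale_leq _ _)) // size_polyXn.
exact: ltn_ord.
Qed.

Lemma wnorm0_scale u v : 0 <= v <= 1 -> v * wnorm 0 (u \Po (v *: 'X)) <= wnorm 0 u.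
Proof.
move=> v01; case/andP: (v01) => v0 v1.
rewrite -(@ler_pXn2r _ 2) ?nnegrE ?mulr_ge0 ?wnorm_ge0 //.
rewrite exprMn !wnorm0_sqr.
have -> : (u \Po (v *: 'X)) ^+ 2 = (u ^+ 2) \Po (v *: 'X) by rewrite rmorphXn.
have sq0 x : 0 <= x <= 1 -> 0 <= (u ^+ 2).[x] by rewrite horner_exp sqr_ge0.
rewrite expr2 -mulrA (le_trans _ (pint_scale_le v01 sq0)) //.
rewrite ler_piMl // mulr_ge0 // pint_ge0 // => x _.
by rewrite horner_comp horner_exp sqr_ge0.
Qed.

Lemma horner_volterra_poly u v :
  (volterra_poly u).[v] =
  v * pint ((\sum_i (Pv i).[v] *: (Pw i \Po (v *: 'X))) * (u \Po (v *: 'X))).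
Proof.
rewrite /volterra_poly horner_sum mulr_suml linear_sum mulr_sumr.
apply: eq_bigr => i _; rewrite hornerM -pint_scale -scalerAl linearZ /= comp_polyM.
by rewrite /GRing.scale /= mulrCA.
Qed.

(** For fixed v the integrand in theta is a polynomial of degree below 2N + 1, on which the
    quadrature is exact; the only error is that of the kernel, controlled by [gauss_bound]. *)
Lemma KN_volterra_poly q (K : R -> R -> R) eps N (theta delta : 'I_N.+1 -> R) u :
  legendre_gauss theta delta ->
  (forall v w, 0 <= w -> w <= v -> v <= 1 ->
    `|\sum_i (Pv i).[v] * (Pw i).[w] - Ktilde q K v w| <= eps) ->
  (forall i, size (Pw i) <= N)%N -> (size u <= N.+1)%N ->
  forall v, 0 <= v <= 1 ->
  `|KN q K theta delta (horner u) v - (volterra_poly u).[v]| <= eps * wnorm 0 u.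
Proof.
move=> gauss h sPw su v v01; case/andP: (v01) => v0 v1.
pose uv := u \Po (v *: 'X).
have suv : (size uv <= N.+1)%N by exact: leq_trans (size_comp_scale _ _) su.
have -> : KN q K theta delta (horner u) v - (volterra_poly u).[v] =
   - (v * \sum_k (\sum_i (Pv i).[v] * (Pw i).[v * theta k] - Ktilde q K v (v * theta k))
     * uv.[theta k] * delta k).
  rewrite horner_volterra_poly -(gauss_exact gauss); last first.
    have sQ : (size (\sum_i (Pv i).[v] *: (Pw i \Po (v *: 'X)))%R <= N)%N.
      apply: (leq_trans (size_sum _ _ _)); apply/bigmax_leqP => i _.
      rewrite (leq_trans (size_scale_leq _ _)) // (leq_trans (size_comp_scale _ _)) //.
    apply: (leq_trans (size_polyMleq _ _)); apply: leq_trans (leq_pred _) _.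
    by apply: leq_add => //; exact: leq_trans sQ (leqnSn _).
  rewrite /KN -mulrBr -mulrN; congr (_ * _); rewrite -sumrB -sumrN.
  apply: eq_bigr => k _; rewrite hornerM horner_sum /uv horner_comp hornerZ hornerX.
  have -> : \sum_i ((Pv i).[v] *: (Pw i \Po (v *: 'X))).[theta k] =
      \sum_i (Pv i).[v] * (Pw i).[v * theta k].
    by apply: eq_bigr => i _; rewrite hornerZ horner_comp hornerZ hornerX.
  by ring.
rewrite normrN normrM (ger0_norm v0).
have b : `|\sum_k (\sum_i (Pv i).[v] * (Pw i).[v * theta k] - Ktilde q K v (v * theta k))
     * uv.[theta k] * delta k| <= eps * wnorm 0 uv.
  apply: (gauss_bound gauss
    (f := fun x => \sum_i (Pv i).[v] * (Pw i).[v * x] - Ktilde q K v (v * x))) => //.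
  move=> x /andP[x0 x1]; apply: h => //; first exact: mulr_ge0.
  by rewrite ler_piMr.
apply: (le_trans (ler_wpM2l v0 b)); rewrite mulrCA ler_wpM2l ?wnorm0_scale //.
by rewrite (le_trans _ (h 0 0 _ _ _)).
Qed.

(** Cauchy-Schwarz bounds the square of the value at v by M^2 times the integral of u^2 over [0, v].
    As the weight decreases, W(v) may be moved inside that integral, which is why n does not enter
    the constant. *)
Lemma volterra_poly_wnorm n M u : 0 <= M ->
  (forall v w, 0 <= w -> w <= v -> v <= 1 ->
    `|\sum_i (Pv i).[v] * (Pw i).[w]| <= M) ->
  wnorm n (volterra_poly u) <= M * wnorm n u.
Proof.
move=> M0 h; apply: wnorm_le_sup; first by rewrite mulr_ge0 ?wnorm_ge0.
move=> v v01; case/andP: (v01) => v0 v1.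
pose uv := u \Po (v *: 'X).
pose Q := \sum_i (Pv i).[v] *: (Pw i \Po (v *: 'X)).
have hQ x : 0 <= x <= 1 -> `|Q.[x]| <= M.
  move=> /andP[x0 x1]; rewrite /Q horner_sum.
  have -> : \sum_i ((Pv i).[v] *: (Pw i \Po (v *: 'X))).[x] =
      \sum_i (Pv i).[v] * (Pw i).[v * x].
    by apply: eq_bigr => i _; rewrite hornerZ horner_comp hornerZ hornerX.
  by apply: h => //; [exact: mulr_ge0|rewrite ler_piMr].
have W0 : 0 <= (weight n).[v] by rewrite (le_trans ler01) // weight_ge1.
have T1 : (volterra_poly u).[v] ^+ 2 <= M ^+ 2 * (prim (u ^+ 2)).[v].
  rewrite horner_volterra_poly -/uv -/Q exprMn.
  have cs : pint (Q * uv) ^+ 2 <= M ^+ 2 * pint (uv ^+ 2).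
    have := @wnorm_cs R 0 Q uv; rewrite /weight expr0 mul1r => cs.
    have wQ : wnorm 0 Q <= M by exact: wnorm0_le_sup.
    rewrite -wnorm0_sqr -exprMn -[leLHS]real_normK ?num_real //.
    rewrite lerXn2r ?nnegrE ?mulr_ge0 ?wnorm_ge0 //.
    by apply: le_trans cs _; rewrite ler_wpM2r ?wnorm_ge0.
  apply: (le_trans (ler_wpM2l (sqr_ge0 v) cs)); rewrite mulrCA ler_wpM2l ?sqr_ge0 //.
  rewrite -pint_scale rmorphXn /= -/uv expr2 -mulrA ler_piMl // mulr_ge0 //.
  by apply: pint_ge0 => x _; rewrite horner_exp sqr_ge0.
apply: (le_trans (ler_wpM2l W0 T1)); rewrite mulrCA exprMn ler_wpM2l ?sqr_ge0 //.
rewrite wnorm_sqr.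
have W1 : (weight n).[v] * (prim (u ^+ 2)).[v] <= (prim (weight n * u ^+ 2)).[v].
  have := @prim_homo R (weight n * u ^+ 2 - (weight n).[v] *: u ^+ 2) 0 v v0.
  have -> : prim (weight n * u ^+ 2 - (weight n).[v] *: u ^+ 2) =
    prim (weight n * u ^+ 2) - (weight n).[v] *: prim (u ^+ 2).
    by rewrite primD -scaleNr primZ scaleNr.
  rewrite !(hornerD, hornerN, hornerZ) !prim0 mulr0 subrr subr_ge0; apply.
  move=> x /andP[x0 xv]; rewrite hornerD hornerN hornerZ hornerM -mulrBl.
  rewrite mulr_ge0 ?subr_ge0 ?weight_anti //.
  by rewrite [(u ^+ 2).[x]]horner_exp sqr_ge0.
apply: le_trans W1 _; apply: prim_homo => // x /andP[vx x1].
by apply: weight_sqr_ge0; rewrite x1 (le_trans v0).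
Qed.

End SeparatedVolterra.

(** * Approximation of Volterra images by polynomials of low degree *)

Section VolterraApproximation.
Context {R : realType}.
Implicit Types (u B : {poly R}).

(** The natural bound is C |u| (x - y)^(1/2); it is weakened to the form a + b (x - y)^2 that
    [bernstein_approx] takes as input, with eta free. *)
Lemma prim_modulus B u C eta : 0 <= C -> 0 < eta ->
  (forall x, 0 <= x <= 1 -> `|B.[x]| <= C) ->
  forall x y, 0 <= x <= 1 -> 0 <= y <= 1 ->
  `|(prim (B * u)).[x] - (prim (B * u)).[y]| <=
  C * wnorm 0 u * (eta + eta ^- 3 * (x - y) ^+ 2).
Proof.
move=> C0 e0 hB.
suff main x y : 0 <= y -> y <= x -> x <= 1 ->
    `|(prim (B * u)).[x] - (prim (B * u)).[y]| <=
    C * wnorm 0 u * (eta + eta ^- 3 * (x - y) ^+ 2).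
  move=> x y /andP[x0 x1] /andP[y0 y1]; have [yx|xy] := leP y x; first exact: main.
  by rewrite distrC -[(x - y) ^+ 2]sqrrN opprB; apply: main => //; exact: ltW.
move=> y0 yx x1.
have [u0|nu0] := eqVneq (wnorm 0 u) 0.
  have -> : prim (B * u) = 0.
    by rewrite (wnorm_eq0 u0) mulr0; apply/polyP => i; rewrite coef_prim !coef0 mul0r.
  by rewrite !horner0 subrr normr0 u0 mulr0 mul0r.
have n0 : 0 < wnorm 0 u by rewrite lt_neqAle eq_sym nu0 wnorm_ge0.
(* AM-GM: |B u| <= C (alpha u^2 + 1 / alpha) / 2, integrated over [y, x] *)
pose al := eta / wnorm 0 u.
have al0 : 0 < al by rewrite divr_gt0.
pose h := (C / 2) *: (al *: u ^+ 2 + al^-1%:P).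
have hh z : 0 <= z <= 1 -> `|(B * u).[z]| <= h.[z].
  move=> z01; rewrite hornerM normrM /h hornerZ hornerD hornerZ horner_exp hornerC.
  apply: (le_trans (ler_wpM2r (normr_ge0 _) (hB z z01))).
  rewrite -mulrA ler_wpM2l // -[u.[z] ^+ 2]real_normK ?num_real //.
  move: (`|u.[z]|) => w; rewrite mulrC ler_pdivlMr //.
  have : 0 <= al^-1 * (al * w - 1) ^+ 2 by rewrite mulr_ge0 ?sqr_ge0 // invr_ge0 ltW.
  have -> : al^-1 * (al * w - 1) ^+ 2 = al * w ^+ 2 + al^-1 - w * 2.
    by field; rewrite gt_eqF.
  by rewrite subr_ge0.
have primB (p r : {poly R}) : prim (p - r) = prim p - prim r.
  by rewrite primD -scaleN1r primZ scaleN1r.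
have yx01 z : y <= z <= x -> 0 <= z <= 1.
  by move=> /andP[yz zx]; rewrite (le_trans y0 yz) (le_trans zx x1).
have up : (prim (B * u)).[x] - (prim (B * u)).[y] <= (prim h).[x] - (prim h).[y].
  have := @prim_homo R (h - B * u) y x yx; rewrite primB !(hornerD, hornerN) => H.
  have {}H : (prim h).[y] - (prim (B * u)).[y] <= (prim h).[x] - (prim (B * u)).[x].
    apply: H => z /yx01 /hh; rewrite ler_norml => /andP[_].
    by rewrite hornerD hornerN subr_ge0.
  lra.
have lo : - ((prim h).[x] - (prim h).[y]) <= (prim (B * u)).[x] - (prim (B * u)).[y].
  have := @prim_homo R (h + B * u) y x yx; rewrite primD !(hornerD) => H.
  have {}H : (prim h).[y] + (prim (B * u)).[y] <= (prim h).[x] + (prim (B * u)).[x].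
    apply: H => z /yx01 /hh; rewrite ler_norml => /andP[+ _].
    by rewrite hornerD; lra.
  lra.
have hd : (prim h).[x] - (prim h).[y] <=
    C * wnorm 0 u * (eta + eta ^- 3 * (x - y) ^+ 2).
  have mon (a b : R) : 0 <= a -> b <= 1 -> a <= b -> (prim (u ^+ 2)).[a] <= (prim (u ^+ 2)).[b].
    by move=> *; apply: prim_homo => // z _; rewrite horner_exp sqr_ge0.
  have P1 : (prim (u ^+ 2)).[x] - (prim (u ^+ 2)).[y] <= wnorm 0 u ^+ 2.
    rewrite wnorm0_sqr lerBlDr (le_trans (mon x 1 (le_trans y0 yx) (lexx _) x1)) //.
    by rewrite lerDl -(prim0 (u ^+ 2)) mon // (le_trans yx).
  have pC (a : R) : prim a%:P = a *: 'X.
    have := prim_deriv (a *: 'X); rewrite derivZ derivX alg_polyC => ->.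
    by rewrite !hornerZ hornerX mulr0 subr0.
  have -> : (prim h).[x] - (prim h).[y] =
      C / 2 * (al * ((prim (u ^+ 2)).[x] - (prim (u ^+ 2)).[y]) + al^-1 * (x - y)).
    by rewrite /h primZ primD primZ pC !(hornerZ, hornerD, hornerX); ring.
  apply: (@le_trans _ _ (C / 2 * (al * wnorm 0 u ^+ 2 + al^-1 * (x - y)))).
    by rewrite ler_wpM2l ?divr_ge0 // lerD2r ler_wpM2l // ltW.
  have -> : C / 2 * (al * wnorm 0 u ^+ 2 + al^-1 * (x - y)) =
     C * wnorm 0 u * ((eta + (x - y) / eta) / 2).
    by rewrite /al; field; rewrite !gt_eqF.
  apply: ler_wpM2l; first by rewrite mulr_ge0 // ltW.
  have e3 : 0 < eta ^- 3 by rewrite invr_gt0 exprn_gt0.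
  (* Completing the square gives (x - y) / eta <= eta + eta^(-3) (x - y)^2. *)
  have : 0 <= eta ^- 3 * ((eta ^+ 2 - (x - y)) ^+ 2 / 2 + eta ^+ 4 / 2 + (x - y) ^+ 2 / 2).
    by rewrite mulr_ge0 ?(ltW e3) // !addr_ge0 // divr_ge0 // ?sqr_ge0 // exprn_ge0 // ltW.
  have -> : eta ^- 3 * ((eta ^+ 2 - (x - y)) ^+ 2 / 2 + eta ^+ 4 / 2 + (x - y) ^+ 2 / 2) =
     eta + eta ^- 3 * (x - y) ^+ 2 - (x - y) / eta.
    by field; rewrite gt_eqF.
  have : 0 <= eta ^- 3 * (x - y) ^+ 2 by rewrite mulr_ge0 ?sqr_ge0 // ltW.
  by move: ((x - y) / eta) (eta ^- 3 * (x - y) ^+ 2) => a b; lra.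
by rewrite ler_norml (le_trans up hd) andbT (le_trans _ lo) // lerN2.
Qed.

Lemma family_bounded01 m (P : 'I_m -> {poly R}) :
  exists C, 0 <= C /\ forall i x, 0 <= x <= 1 -> `|(P i).[x]| <= C.
Proof.
pose c i := sval (cid (poly_bounded01 (P i))).
have hc i : 0 <= c i /\ forall x, 0 <= x <= 1 -> `|(P i).[x]| <= c i.
  exact: svalP (cid (poly_bounded01 (P i))).
exists (\sum_i c i); split; first by apply: sumr_ge0 => i _; case: (hc i).
move=> i x x01; case: (hc i) => _ /(_ x x01) /le_trans; apply.
by rewrite (bigD1 i) //= lerDl sumr_ge0 // => j _; case: (hc j).
Qed.

(** Only the primitives are replaced by Bernstein polynomials; their degree d = N - sv leaves room
    for the factors [Pv i]. The threshold is uniform in u. *)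
Lemma volterra_poly_approx m (Pv Pw : 'I_m -> {poly R}) eps : 0 < eps ->
  exists N0, forall N, (N0 <= N)%N -> forall u,
  exists Y : {poly R}, (size Y <= N)%N /\
  forall v, 0 <= v <= 1 ->
    `|Y.[v] - (volterra_poly Pv Pw u).[v]| <= eps * wnorm 0 u.
Proof.
move=> e0.
have [Cv [Cv0 hv]] := family_bounded01 Pv.
have [Cw [Cw0 hw]] := family_bounded01 Pw.
pose c := m%:R * (Cv * Cw) + 1.
have c0 : 0 < c by rewrite ltr_wpDl // mulr_ge0 // mulr_ge0.
(* Each of the m terms contributes Cv Cw |u| 2 eta; the summand 1 in c keeps it positive when the
   family is empty or zero. *)
pose eta := eps / (2 * c).
have eta0 : 0 < eta by rewrite divr_gt0 // mulr_gt0.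
have b0 : 0 < eta ^- 3 by rewrite invr_gt0 exprn_gt0.
have [d0 hd0] := ltr_add_invr (divr_gt0 eta0 b0); rewrite add0r in hd0.
pose sv := (\max_i size (Pv i))%N.
exists (sv + d0.+1)%N => N NN u; pose d := (N - sv)%N.
have dd : (d0 < d)%N by rewrite /d; lia.
have db : eta ^- 3 / d%:R <= eta.
  have dR : 0 < d%:R :> R by rewrite ltr0n (leq_ltn_trans _ dd).
  move: hd0; rewrite ltr_pdivlMr // => /ltW; apply: le_trans.
  rewrite mulrC ler_wpM2r ?(ltW b0) //.
  have d0R : 0 < d0.+1%:R :> R by rewrite ltr0n.
  have dd' : d0.+1%:R <= d%:R :> R by rewrite ler_nat.
  by rewrite lef_pV2.
pose F i := prim (Pw i * u).
pose Bi i := bernstein d (fun j => (F i).[j%:R / d%:R]).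
exists (\sum_i Pv i * Bi i); split.
  apply: (leq_trans (size_sum _ _ _)); apply/bigmax_leqP => i _.
  rewrite (leq_trans (size_polyMleq _ _)) //.
  have h1 : (size (Pv i) <= sv)%N by exact: leq_bigmax.
  have h2 : (size (Bi i) <= d.+1)%N by exact: size_bernstein.
  by rewrite -subn1 (leq_trans (leq_sub2r 1 (leq_add h1 h2))) // /d; lia.
move=> v v01; rewrite horner_sum /volterra_poly horner_sum -sumrB.
apply: (le_trans (ler_norm_sum _ _ _)).
have each i : `|(Pv i * Bi i).[v] - (Pv i * prim (Pw i * u)).[v]| <=
    Cv * Cw * wnorm 0 u * (2 * eta).
  rewrite !hornerM -mulrBr normrM -!mulrA; apply: ler_pM => //; first exact: hv.
  rewrite mulrA; set k := Cw * wnorm 0 u.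
  have k0 : 0 <= k by rewrite mulr_ge0 ?wnorm_ge0.
  have ap := @bernstein_approx R (horner (F i)) (k * eta) (k * eta ^- 3) d.
  apply: le_trans (ap (leq_ltn_trans (leq0n _) dd) _ _ v v01) _.
  - by rewrite mulr_ge0 // ltW.
  - move=> x y x01 y01; rewrite -[k * _ * _]mulrA -mulrDr.
    exact: (@prim_modulus (Pw i) u Cw eta Cw0 eta0 (hw i) x y x01 y01).
  have -> : k * eta + k * eta ^- 3 / d%:R = k * (eta + eta ^- 3 / d%:R) by ring.
  by rewrite ler_wpM2l // mulr_natl mulr2n lerD2l.
apply: (le_trans (ler_sum _ (fun i _ => each i))).
rewrite sumr_const card_ord -[X in X <= _]mulr_natl.
have -> : m%:R * (Cv * Cw * wnorm 0 u * (2 * eta)) =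
    (m%:R * (Cv * Cw)) * (2 * eta) * wnorm 0 u by ring.
rewrite ler_wpM2r ?wnorm_ge0 //.
have -> : eps = c * (2 * eta) by rewrite /eta; field; rewrite gt_eqF.
have cc : m%:R * (Cv * Cw) <= c by rewrite /c lerDl.
have e2 : 0 <= 2 * eta by rewrite mulr_ge0 // ltW.
exact: ler_wpM2r e2 _ _ cc.
Qed.

End VolterraApproximation.

(** * The homogeneous discrete system *)

Section GalerkinInjectivity.
Context {R : realType} (q lambda : R) (K : R -> R -> R).
Hypotheses (q_gt0 : 0 < q) (q_lt1 : q < 1).
Hypothesis K_cont : {within triangle, continuous (fun z : R * R => K z.1 z.2)}.

Lemma size_caputo_poly (u : {poly R}) N : (size u <= N.+1)%N ->
  (size (caputo_poly q u) <= N)%N.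
Proof.
move=> su; apply/leq_sizeP => j Nj; rewrite coef_caputo_poly coef_deriv.
by rewrite nth_default ?mul0rn ?mulr0 // (leq_trans su).
Qed.

Lemma coef_caputo_poly_coef (u : {poly R}) i :
  (caputo_poly q u)`_i = caputo_coef q i * u`_i.+1.
Proof.
by rewrite coef_caputo_poly coef_deriv -[_ *+ i.+1]mulr_natl /caputo_coef mulrA.
Qed.

(* u and X (M^q u) / kappa have the same leading term, kappa being the factor
   by which M^q scales the top monomial; so u is within |M^q u| / kappa of the
   polynomials of lower degree. *)
Lemma size_lower_degree (u : {poly R}) N : (size u <= N.+2)%N ->
  (size (u - (caputo_coef q N)^-1 *: ('X * caputo_poly q u))%R <= N.+1)%N.
Proof.
move=> su; apply/leq_sizeP => j; rewrite leq_eqVlt => /predU1P[<-|Nj].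
  rewrite coefB coefZ coefXM /= coef_caputo_poly_coef mulKf ?subrr //.
  by rewrite gt_eqF // caputo_coef_gt0.
rewrite coefB coefZ coefXM; case: j Nj => // j Nj /=.
by rewrite coef_caputo_poly_coef nth_default ?mulr0 ?subrr // (leq_trans su).
Qed.

(** The constants 16 and 32 turn the hypotheses into G <= (7/16) G. *)
Lemma absorption_eq0 (S l G nu ng k eps r0 : R) : 1 <= S -> 0 <= l -> 0 <= G ->
  0 <= k -> k <= (16 * S)^-1 -> eps = (32 * S * (l + 1))^-1 ->
  nu <= G -> ng <= G -> G <= 2 * S * r0 ->
  r0 <= 2 * (k * ng) + 3 * (l * (eps * nu)) -> G = 0.
Proof.
move=> S1 l0 G0 k0 kS epsE hu hg hG hr.
have S0 : 0 < S by lra.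
have e0 : 0 <= eps by rewrite epsE invr_ge0 !mulr_ge0 //; lra.
have a1 : S * (k * ng) <= G / 16.
  have : k * ng <= (16 * S)^-1 * G.
    by apply: (le_trans (ler_wpM2l k0 hg)); rewrite ler_wpM2r.
  move=> /(ler_wpM2l (ltW S0)) /le_trans; apply.
  by rewrite le_eqVlt; apply/orP; left; apply/eqP; field; rewrite gt_eqF.
have a2 : S * (l * (eps * nu)) <= G / 32.
  have : eps * nu <= eps * G by rewrite ler_wpM2l.
  move=> /(ler_wpM2l l0) /(ler_wpM2l (ltW S0)) /le_trans; apply.
  have -> : S * (l * (eps * G)) = (l / (l + 1)) * (G / 32).
    by rewrite epsE; field; rewrite !gt_eqF //; lra.
  rewrite ler_piMl ?divr_ge0 // ler_pdivrMr; lra.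
have a3 : S * r0 <= S * (2 * (k * ng) + 3 * (l * (eps * nu))) by rewrite ler_pM2l.
move: a3 hG; rewrite mulrDr -mulrA.
have -> : S * (2 * (k * ng)) = 2 * (S * (k * ng)) by ring.
have -> : S * (3 * (l * (eps * nu))) = 3 * (S * (l * (eps * nu))) by ring.
move: (S * (k * ng)) (S * (l * (eps * nu))) (S * r0) a1 a2 => a b c a1 a2 a3 hG.
by apply/eqP; rewrite eq_le G0 andbT; lra.
Qed.

Lemma galerkin_homogeneous_trivial : exists N0 : nat, forall N : nat, (N0 <= N)%N ->
  forall theta delta : 'I_N.+1 -> R, legendre_gauss theta delta ->
  forall t : {poly R}, (size t <= N)%N ->
  (forall phi : {poly R}, (size phi <= N)%N ->
     pint (caputo_poly q ('X * t) * phi) =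
     \sum_k ('X * t).[theta k] * phi.[theta k] * delta k +
     lambda * \sum_k KN q K theta delta (horner ('X * t)) (theta k)
                       * phi.[theta k] * delta k) ->
  t = 0.
Proof.
have [M [M0 hM]] := Ktilde_bounded q_gt0 q_lt1 K_cont.
(* C0 bounds u + lambda T u in terms of u in every weighted norm; the energy constant 2 C0 will make
   this at most half of the norm of g. *)
pose C0 := 1 + `|lambda| * (M + 1).
have C01 : 1 <= C0 by rewrite lerDl mulr_ge0 // addr_ge0.
have [n energy] := caputo_energy q_gt0 q_lt1 (2 * C0).
pose S : R := 2 ^+ n.
have S1 : 1 <= S by rewrite exprn_ege1 // ler1n.
have l1 : 0 < `|lambda| + 1 by rewrite ltr_wpDl.
have S0 : 0 < S by rewrite (lt_le_trans ltr01).
pose eps := (32 * S * (`|lambda| + 1))^-1.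
have eps0 : 0 < eps by rewrite invr_gt0 !mulr_gt0.
have eps1 : eps <= 1.
  rewrite invf_le1 ?mulr_gt0 //.
  have : 1 * 1 <= S * (`|lambda| + 1) by apply: ler_pM => //; rewrite lerDr.
  by rewrite -mulrA; move: (S * _) => y; lra.
have [m [Pv [Pw hP]]] := Ktilde_approx q_gt0 q_lt1 K_cont eps0.
have hPM v w : 0 <= w -> w <= v -> v <= 1 -> `|\sum_i (Pv i).[v] * (Pw i).[w]| <= M + 1.
  move=> w0 wv v1; rewrite -[\sum_i _](subrK (Ktilde q K v w)).
  apply: (le_trans (ler_normD _ _)); rewrite addrC lerD ?hM //.
  exact: le_trans (hP v w w0 wv v1) eps1.
have [N1 hN1] := @volterra_poly_approx R m Pv Pw eps eps0.
have [N2 hN2] := caputo_coef_unbounded q_gt0 q_lt1 (16 * S).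
pose sw := (\max_i size (Pw i))%N.
exists (maxn N1 (maxn N2.+1 sw)) => N; rewrite !geq_max => /and3P[NN1 NN2 Nsw].
move=> theta delta gauss t st gal.
(* N is now one less than the number of unknowns: [caputo_coef q N] is the factor on the top
   monomial of u, and test polynomials have size at most N + 1. *)
case: N NN1 NN2 Nsw theta delta gauss st gal => // N NN1 NN2 Nsw theta delta gauss st gal.
pose u := 'X * t; pose g := caputo_poly q u; pose T := volterra_poly Pv Pw u.
have su : (size u <= N.+2)%N.
  by rewrite /u (leq_trans (size_polyMleq _ _)) // size_polyX.
have sg : (size g <= N.+1)%N by exact: size_caputo_poly.
have [Y [sY hY]] := hN1 N.+1 NN1 u.
pose k := (caputo_coef q N)^-1.
have k0 : 0 < k by rewrite invr_gt0 caputo_coef_gt0.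
have kS : k <= (16 * S)^-1.
  by rewrite lef_pV2 ?posrE ?caputo_coef_gt0 ?mulr_gt0 // hN2.
have sU := size_lower_degree su; rewrite -/g -/k in sU.
pose nu := wnorm 0 u; pose ng := wnorm 0 g.
(* The residual with u and T u replaced by approximations of admissible degree, hence a legitimate
   test polynomial. *)
pose phi := g - (u - k *: ('X * g)) - lambda *: Y.
have sphi : (size phi <= N.+1)%N.
  rewrite (leq_trans (size_polyD _ _)) // geq_max size_polyN.
  rewrite (leq_trans (size_scale_leq _ _)) // andbT.
  by rewrite (leq_trans (size_polyD _ _)) // geq_max sg size_polyN.
have sumY : \sum_j Y.[theta j] * phi.[theta j] * delta j = pint (Y * phi).
  rewrite -(gauss_exact gauss); first by apply: eq_bigr => j _; rewrite hornerM.
  apply: (leq_trans (size_polyMleq _ _)); apply: leq_trans (leq_pred _) _.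
  by apply: leq_add; [exact: leq_trans sY (leqnSn _)|exact: leq_trans sphi (leqnSn _)].
have sumu : \sum_j u.[theta j] * phi.[theta j] * delta j = pint (u * phi).
  rewrite -(gauss_exact gauss); first by apply: eq_bigr => j _; rewrite [(u * phi).[_]]hornerM.
  apply: (leq_trans (size_polyMleq _ _)); apply: leq_trans (leq_pred _) _.
  by apply: leq_add => //; exact: leq_trans sphi (leqnSn _).
have sPw i : (size (Pw i) <= N.+1)%N by apply: leq_trans Nsw; exact: leq_bigmax.
have hKN v : 0 <= v <= 1 ->
    `|KN q K theta delta (horner u) v - T.[v]| <= eps * nu.
  exact: (KN_volterra_poly gauss hP sPw su).
have hKY v : 0 <= v <= 1 ->
    `|KN q K theta delta (horner u) v - Y.[v]| <= 2 * (eps * nu).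
  move=> v01; rewrite -(subrKA T.[v]); apply: (le_trans (ler_normD _ _)).
  by rewrite mulr_natl mulr2n lerD ?hKN // distrC hY.
(* Testing with phi leaves only the two replacement errors, because the quadrature is exact on u phi
   and Y phi. *)
have phi_sqr : wnorm 0 phi ^+ 2 = pint (k *: ('X * g) * phi) + lambda *
    \sum_j (KN q K theta delta (horner u) (theta j) - Y.[theta j]) * phi.[theta j] * delta j.
  have -> : \sum_j (KN q K theta delta (horner u) (theta j) - Y.[theta j])
      * phi.[theta j] * delta j =
     \sum_j KN q K theta delta (horner u) (theta j) * phi.[theta j] * delta j - pint (Y * phi).
    by rewrite -sumY -sumrB; apply: eq_bigr => j _; rewrite !mulrBl.
  have := gal phi sphi; rewrite -/u -/g sumu => galphi.
  have -> : wnorm 0 phi ^+ 2 = pint (g * phi) - pint (u * phi) + pint (k *: ('X * g) * phi)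
      - lambda * pint (Y * phi).
    rewrite wnorm0_sqr -[lambda * pint _]linearZ -!linearB -!linearD -!linearB; congr pint.
    have e : phi = g - u + k *: ('X * g) - lambda *: Y by rewrite /phi; ring.
    by rewrite (scalerAl lambda Y phi) expr2 {1}e; ring.
  by rewrite galphi; ring.
have phi_le : wnorm 0 phi <= k * ng + `|lambda| * (2 * (eps * nu)).
  have [->|p0] := eqVneq (wnorm 0 phi) 0.
    by rewrite addr_ge0 ?mulr_ge0 ?wnorm_ge0 // ltW.
  have p1 : 0 < wnorm 0 phi by rewrite lt_neqAle eq_sym p0 wnorm_ge0.
  rewrite -(ler_pM2r p1) -expr2 phi_sqr mulrDl; apply: lerD.
    have := @wnorm_cs R 0 (k *: ('X * g)) phi; rewrite /weight expr0 mul1r.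
    move=> /(le_trans (ler_norm _)) /le_trans; apply.
    rewrite ler_wpM2r ?wnorm_ge0 // wnormZ (gtr0_norm k0).
    by rewrite ler_wpM2l ?wnorm0_MX // ltW.
  apply: (le_trans (ler_norm _)); rewrite normrM -mulrA ler_wpM2l //.
  apply: (gauss_bound gauss (f := fun v => KN q K theta delta (horner u) v - Y.[v])) => //.
  exact: leq_trans sphi (leqnSn _).
pose r := g - u - lambda *: T.
have r_le : wnorm 0 r <= 2 * (k * ng) + 3 * (`|lambda| * (eps * nu)).
  have -> : r = phi + (- (k *: ('X * g)) + lambda *: (Y - T)).
    by rewrite /r /phi scalerBr; ring.
  apply: (le_trans (wnorm_triangle _ _ _)).
  have h1 := wnorm_triangle 0 (- (k *: ('X * g))) (lambda *: (Y - T)).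
  have h2 : wnorm 0 (- (k *: ('X * g))) <= k * ng.
    by rewrite wnormN wnormZ (gtr0_norm k0) ler_wpM2l ?wnorm0_MX // ltW.
  have h3 : wnorm 0 (lambda *: (Y - T)) <= `|lambda| * (eps * nu).
    rewrite wnormZ ler_wpM2l //; apply: wnorm0_le_sup => v v01.
    by rewrite hornerD hornerN hY.
  apply: le_trans (lerD phi_le (le_trans h1 (lerD h2 h3))) _.
  rewrite (mulrCA `|lambda| 2).
  by move: (k * ng) (`|lambda| * (eps * nu)) => a b; lra.
pose G := wnorm n g.
(* The energy inequality and Cauchy-Schwarz give 2 C0 |u|^2 <= |u| |g| in the weighted norm. *)
have uW : C0 * wnorm n u <= G / 2.
  have := energy t; rewrite -/u -/g -wnorm_sqr => en.
  have [->|p0] := eqVneq (wnorm n u) 0; first by rewrite mulr0 divr_ge0 ?wnorm_ge0.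
  have p1 : 0 < wnorm n u by rewrite lt_neqAle eq_sym p0 wnorm_ge0.
  rewrite -(ler_pM2r p1).
  have := le_trans (ler_norm _) (wnorm_cs n u g); rewrite mulrA => cs.
  have := le_trans en cs; rewrite -/G.
  by move: (wnorm n u) (wnorm n g) => a b; rewrite expr2; lra.
(* |g| <= |r| + C0 |u| <= |r| + |g| / 2 in the weighted norm; the return to the unweighted norm of r
   costs S. *)
have gW : G <= 2 * S * wnorm 0 r.
  have h1 : G <= wnorm n r + (wnorm n u + `|lambda| * wnorm n T).
    have gE : g = r + (u + lambda *: T) by rewrite /r; ring.
    rewrite /G {1}gE; apply: (le_trans (wnorm_triangle _ _ _)); rewrite lerD2l.
    by apply: (le_trans (wnorm_triangle _ _ _)); rewrite wnormZ.
  have h2 : wnorm n T <= (M + 1) * wnorm n u.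
    by apply: volterra_poly_wnorm => //; rewrite addr_ge0.
  have h3 : wnorm n u + `|lambda| * wnorm n T <= C0 * wnorm n u.
    rewrite /C0 mulrDl mul1r lerD2l -mulrA ler_wpM2l //.
  have h4 : wnorm n r <= S * wnorm 0 r by exact: wnorm_le.
  by rewrite -mulrA; lra.
have nuG : nu <= G.
  have h1 : nu <= wnorm n u by exact: wnorm0_le.
  have h2 : wnorm n u <= C0 * wnorm n u by rewrite ler_peMl ?wnorm_ge0.
  have h3 : 0 <= G by exact: wnorm_ge0.
  lra.
have G0 : G = 0.
  apply: (@absorption_eq0 S `|lambda| G nu ng k eps (wnorm 0 r)) => //; try exact: wnorm_ge0.
    exact: ltW.
  exact: wnorm0_le.
have : u = 0.
  by apply: (@wnorm_eq0 R 0); apply/eqP; rewrite eq_le wnorm_ge0 andbT -/nu -G0.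
by move/eqP; rewrite mulf_eq0 polyX_eq0 /= => /eqP.
Qed.

End GalerkinInjectivity.

(** * The linear system *)

Section TriangularFamily.
Context {R : fieldType} (J : nat -> {poly R}).
Hypotheses (sizeJ : forall n, (size (J n) <= n.+1)%N) (leadJ : forall n, (J n)`_n != 0).

Lemma triangular_free N (c : 'I_N -> R) :
  \sum_(j < N) c j *: J j = 0 -> forall j, c j = 0.
Proof.
elim: N c => [|N IH] c; first by move=> _ [].
rewrite big_ord_recr /= => h.
have cN : c ord_max = 0.
  move: (congr1 (fun p : {poly R} => p`_N) h).
  rewrite coefD coefZ coef0 coef_sum big1 ?add0r => [/eqP|j _].
    by rewrite mulf_eq0 (negPf (leadJ N)) orbF => /eqP.
  by rewrite coefZ nth_default ?mulr0 // (leq_trans (sizeJ _)).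
move: h; rewrite cN scale0r addr0 => /IH h j.
case: (unliftP ord_max j) => [i ->|-> //].
rewrite -[RHS](h i); congr c; apply: val_inj => /=.
by rewrite /bump leqNgt ltn_ord.
Qed.

(** Phrased for a predicate closed under linear combinations, so that it applies directly to the
    test polynomials annihilated by the form. *)
Lemma triangular_span N (P : {poly R} -> Prop) : P 0 ->
  (forall a p r, P p -> P r -> P (a *: p + r)) -> (forall i : 'I_N, P (J i)) ->
  forall p : {poly R}, (size p <= N)%N -> P p.
Proof.
move=> P0 PD PJ; suff main m (p : {poly R}) : (m <= N)%N -> (size p <= m)%N -> P p.
  by move=> p; exact: main.
elim: m p => [|m IH] p mN sp.
  by move: sp; rewrite leqn0 size_poly_eq0 => /eqP ->.
pose a := p`_m / (J m)`_m.
rewrite -[p](subrKC (a *: J m)); apply: (PD a (J m) (p - a *: J m)).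
  exact: (PJ (Ordinal mN)).
apply: IH; first exact: ltnW.
apply/leq_sizeP => j; rewrite leq_eqVlt => /predU1P[<-|mj].
  by rewrite coefB coefZ /a divfK ?subrr.
rewrite coefB coefZ (nth_default 0 (leq_trans sp mj)).
by rewrite (nth_default 0 (leq_trans (sizeJ m) mj)) mulr0 subrr.
Qed.

End TriangularFamily.

Section GalerkinSystem.
Context {R : realType} (q lambda : R) (K : R -> R -> R).
Hypotheses (q_gt0 : 0 < q) (q_lt1 : q < 1).
Variables (N : nat) (theta delta : 'I_N.+1 -> R).
Local Notation mu := (@lebesgue_measure R).

Lemma size_jacobi01 n : (size (jacobi01 n : {poly R}) <= n.+1)%N.
Proof. exact: size_poly. Qed.

Lemma lead_jacobi01 n : (jacobi01 n : {poly R})`_n != 0.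
Proof.
rewrite coef_poly ltnSn subnn expr0 mul1r.
by rewrite mulf_neq0 ?invr_neq0 // -?natrM pnatr_eq0 -lt0n ?muln_gt0 ?fact_gt0.
Qed.

(** The value of M^q at 0 is a limit that [Mq_poly] does not compute; the point 0 is removed from
    the integral instead. *)
Lemma inner_Psi j phi :
  inner (Psi q j) (horner phi) = pint (caputo_poly q (jacobi0N1 j) * phi).
Proof.
have E v : v \in `]0, 1]%classic ->
    Psi q j v * phi.[v] = (caputo_poly q (jacobi0N1 j) * phi).[v].
  by rewrite inE /= in_itv /= => /andP[v0 _]; rewrite hornerM /Psi Mq_poly.
have ip : mu.-integrable `]0, 1] (EFin \o horner (caputo_poly q (jacobi0N1 j) * phi)).
  by apply: integrableS (integrable_horner _ 0 1) => //; exact: subset_itv_oc_cc.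
rewrite /inner -Rintegral_itv_obnd_cbnd; last first.
  by apply: eq_integrable ip => // v hv; rewrite /= E.
transitivity (Rintegral mu `]0, 1] (horner (caputo_poly q (jacobi0N1 j) * phi))).
  exact: eq_Rintegral.
by rewrite Rintegral_itv_obnd_cbnd // Rintegral_pint.
Qed.

Definition galerkin_form (p phi : {poly R}) : R :=
  pint (caputo_poly q p * phi)
  - inner_disc theta delta (horner p) (horner phi)
  - lambda * inner_disc theta delta (KN q K theta delta (horner p)) (horner phi).

Lemma galerkin_formDl a p r phi :
  galerkin_form (a *: p + r) phi = a * galerkin_form p phi + galerkin_form r phi.
Proof.
have KD v : KN q K theta delta (horner (a *: p + r)) v =
    a * KN q K theta delta (horner p) v + KN q K theta delta (horner r) v.
  rewrite /KN [a * _]mulrCA -mulrDr; congr (_ * _); rewrite mulr_sumr -big_split.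
  by apply: eq_bigr => k _; rewrite /= hornerD hornerZ; ring.
have pE x y : pint (a *: x + y) = a * pint x + pint y by exact: pint_linear.
rewrite /galerkin_form linearP mulrDl -scalerAl pE /inner_disc.
have -> : \sum_k (a *: p + r).[theta k] * phi.[theta k] * delta k =
  a * \sum_k p.[theta k] * phi.[theta k] * delta k +
  \sum_k r.[theta k] * phi.[theta k] * delta k.
  rewrite mulr_sumr -big_split; apply: eq_bigr => k _.
  by rewrite /= hornerD hornerZ; ring.
have -> : \sum_k KN q K theta delta (horner (a *: p + r)) (theta k) * phi.[theta k] * delta k =
  a * \sum_k KN q K theta delta (horner p) (theta k) * phi.[theta k] * delta k +
  \sum_k KN q K theta delta (horner r) (theta k) * phi.[theta k] * delta k.
  rewrite mulr_sumr -big_split; apply: eq_bigr => k _.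
  by rewrite /= KD; ring.
by ring.
Qed.

Lemma galerkin_formDr a p phi psi :
  galerkin_form p (a *: phi + psi) = a * galerkin_form p phi + galerkin_form p psi.
Proof.
have D (f : R -> R) : inner_disc theta delta f (horner (a *: phi + psi)) =
    a * inner_disc theta delta f (horner phi) + inner_disc theta delta f (horner psi).
  rewrite /inner_disc mulr_sumr -big_split; apply: eq_bigr => k _.
  by rewrite /= hornerD hornerZ; ring.
have pE x y : pint (a *: x + y) = a * pint x + pint y by exact: pint_linear.
by rewrite /galerkin_form mulrDr -scalerAr pE !D; ring.
Qed.

Lemma galerkin_form_sum m (a : 'I_m -> R) (p : 'I_m -> {poly R}) phi :
  galerkin_form (\sum_j a j *: p j) phi = \sum_j a j * galerkin_form (p j) phi.
Proof.
apply: (big_rec2 (fun x y => galerkin_form x phi = y)) => [|j x y _ <-].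
  have := galerkin_formDl (-1) 0 0 phi; rewrite scaler0 addr0 mulN1r addNr.
  by [].
exact: galerkin_formDl.
Qed.

Definition galerkin_matrix : 'M[R]_N :=
  \matrix_(j, i) galerkin_form (jacobi0N1 j.+1) (jacobi01 i).

Lemma galerkin_systemE f a :
  galerkin_system q lambda f K theta delta a <->
  a *m galerkin_matrix = \row_i inner_disc theta delta (bar q f) (horner (jacobi01 i)).
Proof.
have E i : (a *m galerkin_matrix) 0 i = \sum_(j < N) a 0 j *
      (inner (Psi q j.+1) (horner (jacobi01 i))
       - inner_disc theta delta (horner (jacobi0N1 j.+1)) (horner (jacobi01 i))
       - lambda * inner_disc theta delta
                    (KN q K theta delta (horner (jacobi0N1 j.+1)))
                    (horner (jacobi01 i))).
  by rewrite mxE; apply: eq_bigr => j _; rewrite mxE inner_Psi.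
split=> [h|h i]; last by rewrite -E h mxE.
by apply/rowP => i; rewrite E mxE; exact: h.
Qed.

Lemma galerkin_matrix_unit :
  (forall t : {poly R}, (size t <= N)%N ->
    (forall phi : {poly R}, (size phi <= N)%N -> galerkin_form ('X * t) phi = 0) ->
    t = 0) ->
  galerkin_matrix \in unitmx.
Proof.
move=> h; rewrite -row_free_unit; apply: inj_row_free => a a0.
(* The factor 2 is the one in [jacobi0N1], so that X t is the combination with coefficients a. *)
pose t : {poly R} := \sum_(j < N) (a 0 j * 2) *: jacobi01 j.
have Xt : 'X * t = \sum_(j < N) a 0 j *: jacobi0N1 j.+1.
  rewrite /t mulr_sumr; apply: eq_bigr => j _.
  by rewrite /jacobi0N1 /= scalerA -scalerAr.
have t0 : t = 0.
  apply: h.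
    apply: (leq_trans (size_sum _ _ _)); apply/bigmax_leqP => j _.
    by rewrite (leq_trans (size_scale_leq _ _)) // (leq_trans (size_jacobi01 _)).
  apply: (triangular_span size_jacobi01 lead_jacobi01).
  - by have := galerkin_formDr (-1) ('X * t) 0 0; rewrite scaler0 addr0 mulN1r addNr.
  - by move=> c p r hp hr; rewrite galerkin_formDr hp hr mulr0 addr0.
  move=> i; rewrite Xt galerkin_form_sum.
  move/rowP/(_ i): a0; rewrite [in LHS]mxE [in RHS]mxE => e; rewrite -[RHS]e.
  by apply: eq_bigr => j _; rewrite mxE.
apply/rowP => j; rewrite mxE.
have /eqP := triangular_free size_jacobi01 lead_jacobi01 t0 j.
by rewrite mulf_eq0 pnatr_eq0 orbF => /eqP.
Qed.

End GalerkinSystem.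

Unset Implicit Arguments.

Theorem theorem4p7 (R : realType) (q lambda : R) (p f : R -> R)
    (K : R -> R -> R) (hq0 : 0 < q) (hq1 : q < 1 / 2)
    (hp : {within `[0, 1], continuous p})
    (hf : {within `[0, 1], continuous f})
    (hK : C1_on_triangle K)
    (hp1 : forall v : R, 0 <= v <= 1 -> bar q p v = 1)
    (husol : exists u : R -> R,
      transformed_solution q lambda p f K u /\
      forall w : R -> R, transformed_solution q lambda p f K w ->
        forall v : R, 0 <= v <= 1 -> w v = u v) :
  exists N0 : nat, forall N : nat, (N0 <= N)%N ->
    forall theta delta : 'I_N.+1 -> R, legendre_gauss theta delta ->
      (exists! a : 'rV[R]_N, galerkin_system q lambda f K theta delta a) /\
      (exists! uN : {poly R}, galerkin_solution q lambda f K theta delta uN).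
Proof.
have q_lt1 : q < 1 by lra.
have [N0 hN0] := galerkin_homogeneous_trivial lambda hq0 q_lt1 hK.1.
exists N0 => N NN theta delta gauss.
have unitA : galerkin_matrix q lambda K theta delta \in unitmx.
  apply: galerkin_matrix_unit => t st ht; apply: (hN0 N NN theta delta gauss t st).
  move=> phi sphi; have := ht phi sphi; rewrite /galerkin_form /inner_disc; lra.
set A := galerkin_matrix q lambda K theta delta in unitA.
pose b := \row_i inner_disc theta delta (bar q f) (horner (jacobi01 (i : 'I_N))).
have sysE a : galerkin_system q lambda f K theta delta a <-> a = b *m invmx A.
  have [h1 h2] := @galerkin_systemE R q lambda K hq0 q_lt1 N theta delta f a.
  split=> [/h1 e|e]; first by rewrite /b -e mulmxK.
  by apply: h2; rewrite e mulmxKV.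
split; first by exists (b *m invmx A); split=> [|a /sysE]; [exact/sysE|].
pose a := b *m invmx A; exists (\sum_(i < N) a 0 i *: jacobi0N1 i.+1).
split=> [|w [_ [a' [/sysE -> ->]]]] //.
split; last by exists a; split=> //; exact/sysE.
apply: (leq_trans (size_sum _ _ _)); apply/bigmax_leqP => i _.
rewrite (leq_trans (size_scale_leq _ _)) // (leq_trans (size_scale_leq _ _)) //.
rewrite (leq_trans (size_polyMleq _ _)) // size_polyX /=.
by rewrite ltnS (leq_trans (size_jacobi01 i)).
Qed.
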